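(* Let $\mathcal{F}:\mathbb{R}^n\to\mathbb{R}^p$ and $\mathcal{G}:\mathbb{R}^n\to\mathbb{R}^q$ be smooth mappings, and for $b\in\mathbb{R}^p$, $d\in\mathbb{R}^q$ let $$\mathcal{N}(b,d):=\{x\in\mathbb{R}^n:\mathcal{F}(x)=b\}\cap\{x\in\mathbb{R}^n:\mathcal{G}(x)=d\}.$$ Suppose that every point in $\{x\in\mathbb{R}^n:\mathcal{F}(x)=b\}$ satisfies the LICQ property. Then for a generic $d\in\mathbb{R}^q$, every point in $\mathcal{N}(b,d)$ satisfies the LICQ property.
   Context: LICQ (linear independence constraint qualification): a point $x$ of a set defined by equality constraints satisfies LICQ if the Jacobian of all the constraints at $x$ has full row rank. Thus $x\in\{\mathcal{F}=b\}$ satisfies LICQ iff the Jacobian $\mathrm{J}_{\mathcal{F}}(x)\in\mathbb{R}^{p\times n}$ has rank $p$, and $x\in\mathcal{N}(b,d)$ satisfies LICQ iff the stacked Jacobian $[\mathrm{J}_{\mathcal{G}}(x);\mathrm{J}_{\mathcal{F}}(x)]\in\mathbb{R}^{(p+q)\times n}$ has rank $p+q$. ''Generic $d\in\mathbb{R}^q$'' means all $d\in\mathbb{R}^q$ except for a set of Lebesgue measure $0$. Smooth means $C^\infty$. *)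

(* Defs.v *)
From mathcomp Require Import all_boot all_order all_algebra.
From mathcomp Require Import all_classical all_reals all_analysis.
Export numFieldNormedType.Exports.

Set Implicit Arguments.
Unset Strict Implicit.
Unset Printing Implicit Defensive.
Import Order.TTheory GRing.Theory Num.Theory.

Local Open Scope classical_set_scope.
Local Open Scope ring_scope.

(* R^n is 'rV[R]_n. *)

Fixpoint Ck (R : realType) (n m : nat) (k : nat) (f : 'rV[R]_n -> 'rV[R]_m)
    : Prop :=
  continuous f /\
  if k is k'.+1 then
    forall i : 'I_n, let e := delta_mx 0 i : 'rV[R]_n in
      (forall x, derivable f x e) /\ Ck k' ('D_e f)
  else True.

Definition smooth (R : realType) (n m : nat) (f : 'rV[R]_n -> 'rV[R]_m) : Prop :=
  forall k, Ck k f.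

(* The library's 'J f x acts on row vectors (v *m 'J f x is the differential
   at v), hence has one row per variable; the usual Jacobian matrix, with one
   row per component of f, is its transpose. *)
Definition Jac (R : realType) (n m : nat) (f : 'rV[R]_n -> 'rV[R]_m)
    (x : 'rV[R]_n) : 'M[R]_(m, n) := ('J f x)^T.

Definition level_set (R : realType) (n p : nat) (F : 'rV[R]_n -> 'rV[R]_p)
    (b : 'rV[R]_p) : set 'rV[R]_n := [set x | F x = b].

Definition Nset (R : realType) (n p q : nat)
    (F : 'rV[R]_n -> 'rV[R]_p) (G : 'rV[R]_n -> 'rV[R]_q)
    (b : 'rV[R]_p) (d : 'rV[R]_q) : set 'rV[R]_n := level_set F b `&` level_set G d.

(* For a point of [level_set F b]. *)
Definition LICQ (R : realType) (n p : nat) (F : 'rV[R]_n -> 'rV[R]_p)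
    (x : 'rV[R]_n) : Prop := \rank (Jac F x) = p.

(* For a point of [Nset F G b d]. *)
Definition LICQ_pair (R : realType) (n p q : nat)
    (F : 'rV[R]_n -> 'rV[R]_p) (G : 'rV[R]_n -> 'rV[R]_q)
    (x : 'rV[R]_n) : Prop := \rank (col_mx (Jac G x) (Jac F x)) = (p + q)%N.

Definition box (R : realType) (n : nat) (l u : 'rV[R]_n) : set 'rV[R]_n :=
  [set x | forall i, l 0 i <= x 0 i <= u 0 i].

(* The maximum makes the volume 0 when the box is empty, i.e. when some
   u_i < l_i. *)
Definition box_vol (R : realType) (n : nat) (l u : 'rV[R]_n) : R :=
  \prod_(i < n) Num.max 0 (u 0 i - l 0 i).

(* n-dimensional Lebesgue outer measure. Covers are indexed by an arbitrary
   D : set nat, so finite and empty covers are allowed; this matters only for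
   n = 0, where every box has volume 1. *)
Definition lebesgue_outer (R : realType) (n : nat) (A : set 'rV[R]_n) : \bar R :=
  ereal_inf [set s | exists (D : set nat) (l u : nat -> 'rV[R]_n),
    A `<=` \bigcup_(k in D) box (l k) (u k) /\
    s = \esum_(k in D) (box_vol (l k) (u k))%:E].

(* Lebesgue measure being complete, a set is Lebesgue measurable of measure 0
   iff its outer measure is 0. *)
Definition lebesgue_null (R : realType) (n : nat) (A : set 'rV[R]_n) : Prop :=
  lebesgue_outer A = 0%E.

Definition for_generic (R : realType) (n : nat) (P : 'rV[R]_n -> Prop) : Prop :=
  lebesgue_null [set d | ~ P d].

(* Main.v *)
From HB Require Import structures.
Require Import Defs.
From mathcomp Require Import all_boot all_order all_algebra.
From mathcomp Require Import all_classical all_reals all_analysis.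
From mathcomp Require Import ring lra.

Set Implicit Arguments.
Unset Strict Implicit.
Unset Printing Implicit Defensive.
Import Order.TTheory GRing.Theory Num.Theory.

Local Open Scope classical_set_scope.
Local Open Scope ring_scope.

(** The theorem is Sard's theorem for the restriction of [G] to the level set
    [F = b], which is regular by assumption: if [d] is bad, some [x] with [F x = b]
    and [G x = d] has dependent gradients, so [d] is a critical value of [G]
    restricted to [F = b]. Theorem [sard] shows that these values form a null set.

    The level set is kept implicit, as the zero set of functions on the whole space
    with independent gradients, and the induction lowers its dimension by adding
    constraints. Determinants of the gradients of [F] provide globally defined
    smooth vector fields ([tangent]) that are tangent to all the level sets of [F]
    and span the tangent spaces near a given point. Deriving along them ([tder])
    keeps one within the smooth functions on R^n. The critical points of [G] then
    fall into three countable families, locally ([null_critset_local]).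

    If a tangential derivative of some component [G j] is nonzero, then the points
    with [G j = t] lie on the smaller level set [F = b, G j = t] and are critical there for
    the other components. All slices of the set of values are null by induction, and so
    is the set of values, by an elementary version of Fubini's theorem for compact
    sets ([null_of_slices]).

    If an iterated tangential derivative [f] of some [G j] vanishes but a tangential
    derivative of [f] does not, then [f = 0] can be added to the constraints, and the
    point remains critical for [G].

    If all iterated tangential derivatives of all the [G j] vanish, [G] varies on the
    level set by at most a constant times the power [n + 1] of the distance
    ([flat_estimate]). This is Taylor's formula along a path in the level set; the path
    is replaced by the polygons of the Euler method for the tangent fields, whose
    mesh tends to 0. A subdivision of a cube of R^n into small cubes then shows that
    the values form a null set ([null_image_flat]). *)

(** * Sets covered by boxes of small total volume *)

Section Null.
Variable R : realType.

Lemma box_vol_ge0 n (l u : 'rV[R]_n) : 0 <= box_vol l u.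
Proof. by apply: prodr_ge0 => i _; rewrite le_max lexx. Qed.

(** Implies that the outer measure of [A] is at most [e], and holds for every
    [e] above the outer measure; working with the covers themselves spares the
    infimum. *)
Definition covered n (A : set 'rV[R]_n) (e : \bar R) : Prop :=
  exists (D : set nat) (l u : nat -> 'rV[R]_n),
    A `<=` \bigcup_(k in D) box (l k) (u k) /\
    (\esum_(k in D) (box_vol (l k) (u k))%:E <= e)%E.

Lemma covered_countable n (T : countType) (D : set T) (l u : T -> 'rV[R]_n) A e :
  A `<=` \bigcup_(k in D) box (l k) (u k) ->
  (\esum_(k in D) (box_vol (l k) (u k))%:E <= e)%E -> covered A e.
Proof.
move=> Asub De.
pose ext (f : T -> 'rV[R]_n) k := if unpickle k is Some t then f t else 0.
exists (pickle @` D), (ext l), (ext u); split.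
  move=> x /Asub[t Dt xt]; exists (pickle t); first by exists t.
  by rewrite /ext !pickleK.
rewrite esum_image; last first.
  by move=> s t _ _ st; apply: Some_inj; rewrite -!pickleK st.
by under eq_esum do rewrite /ext !pickleK.
Qed.

Lemma covered_le n (A B : set 'rV[R]_n) (d e : \bar R) :
  A `<=` B -> (d <= e)%E -> covered B d -> covered A e.
Proof.
move=> AB de [D [l [u [Bsub Dd]]]]; exists D, l, u; split.
  exact: subset_trans Bsub.
exact: le_trans de.
Qed.

(** Countable subadditivity: the boxes of all the covers are indexed by pairs,
    and a countable index type is as good as [nat]. *)
Lemma covered_bigcup n (T : countType) (S : set T) (A : T -> set 'rV[R]_n)
    (e : T -> \bar R) :
  (forall t, S t -> covered (A t) (e t)) ->
  covered (\bigcup_(t in S) A t) (\esum_(t in S) e t).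
Proof.
move=> covA.
have /choice[D] : forall t, exists D : set nat * ((nat -> 'rV[R]_n) * (nat -> 'rV[R]_n)),
    S t -> A t `<=` \bigcup_(k in D.1) box (D.2.1 k) (D.2.2 k) /\
    (\esum_(k in D.1) (box_vol (D.2.1 k) (D.2.2 k))%:E <= e t)%E.
  move=> t; have [St|nSt] := pselect (S t).
    by have [D [l [u ?]]] := covA t St; exists (D, (l, u)).
  by exists (set0, (fun=> 0, fun=> 0)).
move=> covD.
apply: (@covered_countable n (T * nat)%type (S `*`` (fun t => (D t).1))
  (fun k => (D k.1).2.1 k.2) (fun k => (D k.1).2.2 k.2)).
  move=> x [t St /(covD t St).1 [k Dk xk]]; exists (t, k) => //.
rewrite -(@esum_esum _ _ _ S (fun t => (D t).1)
  (fun t k => (box_vol ((D t).2.1 k) ((D t).2.2 k))%:E)); last first.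
  by move=> *; rewrite lee_fin box_vol_ge0.
by apply: le_esum => t St; exact: (covD t St).2.
Qed.

Definition null n (A : set 'rV[R]_n) : Prop :=
  forall e : R, 0 < e -> covered A e%:E.

Lemma null_sub n (A B : set 'rV[R]_n) : A `<=` B -> null B -> null A.
Proof. by move=> AB nB e /nB; exact: covered_le. Qed.

Lemma null0 n : null (@set0 'rV[R]_n).
Proof.
move=> e e0; exists set0, (fun=> 0), (fun=> 0); split=> //.
by rewrite esum_set0 lee_fin ltW.
Qed.

(** The geometric series, distributed over an arbitrary countable type through
    its encoding in [nat]. *)
Lemma esum_pow2_le (T : countType) (S : set T) (e : R) : 0 <= e ->
  (\esum_(t in S) (e / (2 ^ (pickle t).+1)%:R)%:E <= e%:E)%E.
Proof.
move=> e0.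
rewrite -(@esum_image _ _ _ S pickle
   (fun k => (e / (2 ^ k.+1)%:R)%:E)); last first.
  by move=> s t _ _ st; apply: Some_inj; rewrite -!pickleK st.
have p0 k : (0 <= (e / (2 ^ k.+1)%:R)%:E)%E.
  by rewrite lee_fin divr_ge0.
apply: le_trans (epsilon_trick0 xpredT e0).
rewrite nneseries_esum => [|k _]; last exact: p0.
rewrite esum_mkcond [leRHS]esum_mkcond; apply: le_esum => k _.
by rewrite set_true in_setT; case: ifP.
Qed.

Lemma null_bigcup n (T : countType) (S : set T) (A : T -> set 'rV[R]_n) :
  (forall t, S t -> null (A t)) -> null (\bigcup_(t in S) A t).
Proof.
move=> nA e e0.
apply: (covered_le (fun=> id) (esum_pow2_le S (ltW e0))).
apply: covered_bigcup => t St; apply: nA => //.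
by rewrite divr_gt0.
Qed.

Lemma null_lebesgue n (A : set 'rV[R]_n) : null A -> lebesgue_null A.
Proof.
move=> nA; apply/eqP; rewrite eq_le; apply/andP; split; last first.
  apply: le_ereal_inf_tmp => _ [D [l [u [_ ->]]]].
  by apply: esum_ge0 => k _; rewrite lee_fin box_vol_ge0.
apply/lee_addgt0Pr => e e0; rewrite add0e.
have [D [l [u [Asub De]]]] := nA e e0.
by apply: le_trans De; apply: ereal_inf_lbound; exists D, l, u.
Qed.

(** The volume is a product of continuous functions of the amount by which the
    box is enlarged. Enlarging replaces closed boxes by open ones, which
    compactness arguments need. *)
Lemma box_vol_enlarge n (l u : 'rV[R]_n) (e : R) : 0 < e ->
  exists2 d : R, 0 < d &
    box_vol (l - const_mx d) (u + const_mx d) <= box_vol l u + e.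
Proof.
move=> e0.
pose v (d : R) := \prod_(i < n) Num.max 0 (u 0 i - l 0 i + d *+ 2).
have vE d : box_vol (l - const_mx d) (u + const_mx d) = v d.
  by apply: eq_bigr => i _; rewrite !mxE; congr Num.max; ring.
have v0 : v 0 = box_vol l u.
  by apply: eq_bigr => i _; rewrite mul0rn addr0.
have cv : continuous v.
  apply: continuous_big; first exact: mul_continuous.
  move=> i _ x; apply: (@continuous_max R _ (cst 0) (fun d : R => u 0 i - l 0 i + d *+ 2) x).
    exact: cvg_cst.
  by apply: cvgD; [exact: cvg_cst|apply: cvgMn; exact: cvg_id].
have /cvgrPdist_lt/(_ e e0)/nbhs_ballP[d /= d0 dv] := cv 0.
exists (d / 2); first by rewrite divr_gt0.
have : ball (0 : R) d (d / 2).
  by rewrite /ball /= sub0r normrN gtr0_norm ?divr_gt0// ltr_pdivrMr// ltr_pMr// ltr1n.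
move/dv; rewrite vE -v0 ltr_norml; lra.
Qed.

Definition obox n (l u : 'rV[R]_n) : set 'rV[R]_n :=
  [set x | forall i, l 0 i < x 0 i < u 0 i].

Lemma obox_open n (l u : 'rV[R]_n) : open (obox l u).
Proof.
rewrite openE => x xlu; rewrite /interior.
suff : \forall y \near x, forall i, l 0 i < (y : 'rV[R]_n) 0 i < u 0 i by [].
apply: (@filter_forall _ _ (fun i (y : 'rV[R]_n) => l 0 i < y 0 i < u 0 i) (nbhs x)) => i.
have := @coord_continuous R 1 n 0 i x.
move=> /(_ [set t | l 0 i < t < u 0 i]) /=; apply.
have /andP[lx xu] := xlu i.
near=> t; apply/andP; split; near: t; [exact: lt_nbhsr|exact: lt_nbhsl].
Unshelve. all: by end_near. Qed.

Lemma covered_obox n (A : set 'rV[R]_n) (e d : R) : 0 < d -> covered A e%:E ->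
  exists (D : set nat) (l u : nat -> 'rV[R]_n),
    A `<=` \bigcup_(k in D) obox (l k) (u k) /\
    (\esum_(k in D) (box_vol (l k) (u k))%:E <= (e + d)%:E)%E.
Proof.
move=> d0 [D [l [u [Asub De]]]].
have dk k : 0 < d / (2 ^ k.+1)%:R by rewrite divr_gt0.
have /choice[c cP] : forall k, exists c, 0 < c /\
    box_vol (l k - const_mx c) (u k + const_mx c)
      <= box_vol (l k) (u k) + d / (2 ^ k.+1)%:R.
  by move=> k; have [c ? ?] := box_vol_enlarge (l k) (u k) (dk k); exists c.
exists D, (fun k => l k - const_mx (c k)), (fun k => u k + const_mx (c k)); split.
  move=> x /Asub[k Dk xk]; exists k => // i; rewrite !mxE.
  have /andP[? ?] := xk i; have [? _] := cP k.
  by apply/andP; split; lra.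
apply: (@le_trans _ _ (\esum_(k in D) ((box_vol (l k) (u k))%:E +
    (d / (2 ^ k.+1)%:R)%:E)))%E.
  by apply: le_esum => k _; rewrite -EFinD lee_fin; exact: (cP k).2.
rewrite esumD; last 2 first.
- by move=> k _; rewrite lee_fin box_vol_ge0.
- by move=> k _; rewrite lee_fin ltW.
rewrite EFinD; apply: leeD => //.
exact: (@esum_pow2_le nat D d (ltW d0)).
Qed.

Lemma esum_const_le (T : finType) (D : set T) (c : R) : 0 <= c ->
  (\esum_(t in D) c%:E <= (#|T|%:R * c)%:E)%E.
Proof.
move=> c0; apply: (@le_trans _ _ (\esum_(t in [set: T]) c%:E)).
  rewrite esum_mkcond [leRHS]esum_mkcond; apply: le_esum => t _.
  by rewrite in_setT; case: ifP => //; rewrite lee_fin.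
rewrite esum_fset//; last exact: finite_finset.
rewrite (fsbigE (index_enum T)) ?index_enum_uniq//; last first.
  by move=> i _; rewrite mem_index_enum.
under eq_bigl do rewrite in_setT.
by rewrite sumEFin sumr_const mulr_natl.
Qed.

Lemma esum_scale_le (D : set nat) (v : nat -> R) (c e : R) :
  0 <= c -> (forall k, 0 <= v k) -> (\esum_(k in D) (v k)%:E <= e%:E)%E ->
  (\esum_(k in D) (c * v k)%:E <= (c * e)%:E)%E.
Proof.
move=> c0 v0 De; apply: ge_ereal_sup => _ [X [finX XD] <-].
rewrite EFinM; under eq_fsbigr do rewrite EFinM.
rewrite -ge0_mule_fsumr//; apply: lee_pmul => //.
- by apply: fsume_ge0 => k _; rewrite lee_fin.
- by apply: le_trans De; apply: ereal_sup_ubound; exists X.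
Qed.

End Null.

(** * A compact set with null slices is null *)

Section Fubini.
Variable R : realType.

(** Puts the coordinate [a] back at position [j]: a right inverse of [col' j], used
    to thicken a box of the hyperplane into a box of the whole space. *)
Definition ins q (j : 'I_q.+1) (a : R) (y : 'rV[R]_q) : 'rV[R]_q.+1 :=
  \row_i if unlift j i is Some k then y 0 k else a.

Lemma box_ins q (j : 'I_q.+1) (a b : R) (l u : 'rV[R]_q) (x : 'rV[R]_q.+1) :
  a <= x 0 j <= b -> box l u (col' j x) -> box (ins j a l) (ins j b u) x.
Proof.
move=> xj xlu i; rewrite !mxE; case: unliftP => [k ->|-> //].
by have := xlu k; rewrite !mxE.
Qed.

Lemma box_vol_ins q (j : 'I_q.+1) (a b : R) (l u : 'rV[R]_q) : a <= b ->
  box_vol (ins j a l) (ins j b u) = (b - a) * box_vol l u.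
Proof.
move=> ab; rewrite /box_vol (bigD1_ord j)//= !mxE unlift_none; congr (_ * _).
  by rewrite max_r// subr_ge0.
by apply: eq_bigr => i _; rewrite !mxE liftK.
Qed.

Lemma covered_slab q (j : 'I_q.+1) (A : set 'rV[R]_q.+1) (a b e : R) :
  a <= b -> (forall x, A x -> a <= x 0 j <= b) ->
  covered [set col' j x | x in A] e%:E -> covered A ((b - a) * e)%:E.
Proof.
move=> ab Aj [D [l [u [Asub De]]]].
exists D, (fun k => ins j a (l k)), (fun k => ins j b (u k)); split.
  move=> x Ax; have [|k Dk xk] := Asub (col' j x); first by exists x.
  by exists k => //; apply: box_ins => //; exact: Aj.
under eq_esum do rewrite box_vol_ins//.
apply: esum_scale_le => //; first by rewrite subr_ge0.
by move=> k; exact: box_vol_ge0.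
Qed.

Lemma near_dist_lt (V : normedModType R) (x : V) (e : R) : 0 < e ->
  \forall y \near x, `|x - y| < e.
Proof. by move=> e0; apply/nbhs_ballP; exists e => // y; rewrite -ball_normE. Qed.

Lemma coord_cvg n (i : 'I_n) (x : 'rV[R]_n) :
  (fun y : 'rV[R]_n => y 0 i) @ x --> x 0 i.
Proof. exact: coord_continuous. Qed.

Lemma col'_continuous q (j : 'I_q.+1) :
  continuous (col' j : 'rV[R]_q.+1 -> 'rV[R]_q).
Proof.
move=> x; apply/(@cvgrPdist_lt _ _ _ (nbhs x) (nbhs_filter x)) => e e0.
have := near_dist_lt x e0; apply: filterS => y xy.
apply: le_lt_trans xy.
rewrite [leLHS]/Num.Def.normr/= mx_normrE; apply: bigmax_le => //= -[i k] _ /=.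
rewrite !mxE ord1 [leRHS]/Num.Def.normr/= mx_normrE.
by apply: le_trans (le_bigmax _ _ (0, lift j k)); rewrite !mxE.
Qed.

(** A tube lemma. Were there no such [d], compactness would produce a point of
    the slice itself that projects outside [U]. *)
Lemma compact_slice_near q (j : 'I_q.+1) (A : set 'rV[R]_q.+1)
    (U : set 'rV[R]_q) (t : R) : compact A -> open U ->
  (forall x, A x -> x 0 j = t -> U (col' j x)) ->
  exists2 d : R, 0 < d &
    forall x, A x -> `|x 0 j - t| <= d -> U (col' j x).
Proof.
move=> /compact_near_coveringP cA oU AU.
pose P (d : R) (x : 'rV[R]_q.+1) := `|x 0 j - t| <= d -> U (col' j x).
have [|d /= d0 dP] := cA R (0^'+) P _ _.
  move=> x Ax; have [xt|xt] := eqVneq (x 0 j) t.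
    have /col'_continuous Ux : nbhs (col' j x) U.
      by apply: open_nbhs_nbhs; split => //; exact: AU.
    exists ([set y : 'rV[R]_q.+1 | U (col' j y)], setT); first by split => //; exact: filterT.
    by move=> [y d] [Uy _] _.
  pose r := `|x 0 j - t|.
  have r2 : 0 < r / 2 by rewrite divr_gt0// normr_gt0 subr_eq0.
  exists ([set y : 'rV[R]_q.+1 | `|x 0 j - y 0 j| < r / 2], [set d | d < r / 2]).
    split; last exact: nbhs_right_lt.
    by move/cvgrPdist_lt : (@coord_cvg _ j x); apply.
  move=> [y d] [/= yr dr] yd; exfalso.
  have := ler_distD (y 0 j) (x 0 j) t; rewrite -/r; lra.
exists (d / 2); first by rewrite divr_gt0.
move=> x Ax; apply: (dP (d / 2)) => //.
- by rewrite /= sub0r normrN gtr0_norm ?divr_gt0// ltr_pdivrMr// ltr_pMr// ltr1n.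
- by rewrite divr_gt0.
Qed.

(** With it the range of a coordinate can be cut into pieces of equal length,
    each of which lies in a single one of the given neighbourhoods. Equal
    pieces overlap in end points only, so their lengths add up exactly to the
    length of the range. *)
Lemma lebesgue_number (m : R) (d : R -> R) : (forall t, 0 < d t) ->
  exists2 c : R, 0 < c & forall s, - m <= s <= m ->
    exists t, forall r, `|r - s| <= c -> `|r - t| <= d t.
Proof.
move=> d0.
have /compact_near_coveringP cm := @segment_compact R (- m) m.
pose P (c : R) (s : R) := exists t, forall r, `|r - s| <= c -> `|r - t| <= d t.
have [|c /= c0 cP] := cm R (0^'+) P _ _.
  move=> s _; have d2 : 0 < d s / 2 by rewrite divr_gt0.
  exists ([set r | `|s - r| < d s / 2], [set c | c < d s / 2]).
    by split; [exact: near_dist_lt|exact: nbhs_right_lt].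
  move=> [r c] [/= sr cd]; exists s => x xr.
  have := ler_distD r x s; rewrite (distrC r s); lra.
exists (c / 2); first by rewrite divr_gt0.
move=> s sm; apply: (cP (c / 2)) => //.
- by rewrite /= sub0r normrN gtr0_norm ?divr_gt0// ltr_pdivrMr// ltr_pMr// ltr1n.
- by rewrite divr_gt0.
Qed.

Lemma compact_coord_bounded n (A : set 'rV[R]_n) (j : 'I_n) : compact A ->
  exists2 m : R, 0 < m & forall x, A x -> - m <= x 0 j < m.
Proof.
move=> /compact_bounded/ex_strict_bound_gt0[m m0 mA]; exists m => // x /mA.
move=> xm; have : `|x 0 j| < m.
  apply: le_lt_trans xm; rewrite [leRHS]/Num.Def.normr/= mx_normrE.
  exact: (le_bigmax _ _ (0, j)).
by rewrite ltr_norml => /andP[/ltW -> ->].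
Qed.

(** Fubini's theorem for null sets, in the compact case. By compactness, an
    open cover of small volume of one slice also covers all the nearby slices;
    finitely many slabs of total width [2m], each covered at a cost [2e'] per
    unit of width, then exhaust the set. *)
Theorem null_of_slices q (j : 'I_q.+1) (A : set 'rV[R]_q.+1) : compact A ->
  (forall t, null [set col' j x | x in A `&` [set x | x 0 j = t]]) ->
  null A.
Proof.
move=> cA nA e e0.
have [m m0 Am] := compact_coord_bounded j cA.
pose e' := e / (m *+ 2) / 2.
have e'0 : 0 < e' by rewrite !divr_gt0 ?mulrn_wgt0.
have e'2 : (m *+ 2) * (e' + e') = e.
  rewrite /e'; field; rewrite ?mulrn_eq0/=; lra.
have /choice[d dP] : forall t, exists d, 0 < d /\
    covered [set col' j x | x in A `&` [set x | `|x 0 j - t| <= d]] (e' + e')%:E.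
  move=> t; have [D [l [u [Asub De]]]] := covered_obox e'0 (nA t e' e'0).
  pose U := \bigcup_(k in D) obox (l k) (u k).
  have oU : open U by apply: bigcup_open => k _; exact: obox_open.
  have [|d d0 dU] := @compact_slice_near _ j A U t cA oU.
    by move=> x Ax xt; apply: Asub; exists x.
  exists d; split => //; exists D, l, u; split => // _ [x [Ax xd] <-].
  have [k Dk xk] := dU x Ax xd; exists k => // i.
  by have /andP[/ltW -> /ltW ->] := xk i.
have [c c0 cP] := @lebesgue_number m d (fun t => (dP t).1).
pose N := (Num.truncn (m *+ 2 / c)).+1.
have N0 : 0 < N%:R :> R by rewrite ltr0n.
pose h := m *+ 2 / N%:R.
have h0 : 0 < h by rewrite divr_gt0// mulrn_wgt0.
have Nh : N%:R * h = m *+ 2 by rewrite mulrC divfK ?gt_eqF.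
have hc : h <= c.
  rewrite /h ler_pdivrMr// mulrC -ler_pdivrMr//.
  by apply/ltW/truncnS_gt.
pose J (i : 'I_N) := A `&` [set x | - m + i%:R * h <= x 0 j <= - m + i.+1%:R * h].
have JA : A `<=` \bigcup_(i in [set: 'I_N]) J i.
  move=> x Ax; have /andP[mx xm] := Am x Ax.
  have xh0 : 0 <= (x 0 j + m) / h by apply: divr_ge0; [lra|exact: ltW].
  have iN : (Num.truncn ((x 0 j + m) / h)%R < N)%N.
    rewrite truncn_lt_nat// ltr_pdivrMr// Nh; lra.
  exists (Ordinal iN) => //; split => //=.
  have /andP[h1 h2] := truncn_itv xh0.
  move: h1 h2; rewrite ler_pdivlMr// ltr_pdivrMr// => h1 h2.
  by apply/andP; split; lra.
apply: (covered_le JA (d := \esum_(i in [set: 'I_N]) (h * (e' + e'))%:E)); last first.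
  apply: covered_bigcup => i _.
  have -> : h = (- m + i.+1%:R * h) - (- m + i%:R * h).
    by rewrite -natr1; ring.
  apply: (@covered_slab _ j); first by rewrite lerD2l ler_pM2r// ler_nat.
    by move=> x [].
  have [|t tP] := cP (- m + i%:R * h).
    have : i%:R * h <= N%:R * h by rewrite ler_pM2r// ler_nat ltnW.
    rewrite Nh => ?.
    have : 0 <= i%:R * h by rewrite mulr_ge0// ltW.
    by move=> ?; apply/andP; split; lra.
  apply: covered_le (dP t).2 => // _ [x [Ax /= /andP[x1 x2]] <-].
  exists x => //; split => //=; apply: tP.
  by rewrite ger0_norm ?subr_ge0//; move: x2; rewrite -natr1 => x2; lra.
apply: le_trans (esum_const_le _ _) _.
  by rewrite mulr_ge0 ?ltW// addr_gt0.
by rewrite card_ord lee_fin mulrA Nh e'2.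
Qed.

End Fubini.

(** * Images under maps that are flat to a high order *)

Section Flat.
Variable R : realType.

Lemma mxnorm_le n (x : 'rV[R]_n) (c : R) : 0 <= c ->
  (forall i, `|x 0 i| <= c) -> `|x| <= c.
Proof.
move=> c0 xc; rewrite [leLHS]/Num.Def.normr/= mx_normrE.
by apply: bigmax_le => // -[i k] _ /=; rewrite ord1.
Qed.

Lemma coord_le_norm n (x : 'rV[R]_n) i : `|x 0 i| <= `|x|.
Proof.
rewrite [leRHS]/Num.Def.normr/= mx_normrE.
exact: (le_bigmax _ _ (0, i)).
Qed.

Lemma box_vol_cube q (y : 'rV[R]_q.+1) (r : R) : 0 <= r ->
  box_vol (y - const_mx r) (y + const_mx r) = (r *+ 2) ^+ q.+1.
Proof.
move=> r0; rewrite /box_vol.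
rewrite (eq_bigr (fun=> r *+ 2)) ?prodr_const ?card_ord// => i _.
rewrite !mxE max_r; last by rewrite subr_ge0; lra.
by ring.
Qed.

(** Each of the [m ^ n] cells of side [s / m] has an image of diameter of order
    [m ^ -(n+1)], hence, in dimension at least one, the images have a total
    volume of order [1 / m]. *)
Theorem null_image_flat n q (Z : set 'rV[R]_n) (G : 'rV[R]_n -> 'rV[R]_q.+1)
    (a : 'rV[R]_n) (s C : R) : 0 < s -> 0 <= C ->
  (forall x, Z x -> forall i, a 0 i <= x 0 i < a 0 i + s) ->
  (forall x y, Z x -> Z y -> `|G y - G x| <= C * `|y - x| ^+ n.+1) ->
  null [set G x | x in Z].
Proof.
move=> s0 C0 Zbox flatG e e0.
(* [K / m ^ (n+1)] is the side of the box that covers the image of one cell; the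
   choice of [m] makes it at most 1 and makes [K / m] at most [e] *)
pose K := C * s ^+ n.+1 *+ 2.
have K0 : 0 <= K by rewrite mulrn_wge0// mulr_ge0// exprn_ge0// ltW.
pose m := (Num.truncn (K + K / e)).+1.
have m0 : 0 < m%:R :> R by rewrite ltr0n.
have Km : K + K / e <= m%:R by apply/ltW/truncnS_gt.
have Ke0 : 0 <= K / e by rewrite divr_ge0// ltW.
pose h := s / m%:R.
have h0 : 0 < h by rewrite divr_gt0.
pose cell (f : {ffun 'I_n -> 'I_m}) :=
  Z `&` [set x | forall i, a 0 i + (f i)%:R * h <= x 0 i <= a 0 i + (f i).+1%:R * h].
have cell_norm f x y : cell f x -> cell f y -> `|y - x| <= h.
  move=> [_ xf] [_ yf]; apply: mxnorm_le; first exact: ltW.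
  move=> i; rewrite !mxE.
  have /andP[] := xf i; have /andP[] := yf i; rewrite -natr1 mulrDl mul1r.
  by rewrite ler_norml => *; apply/andP; split; lra.
have /choice[c cP] : forall f, exists x, cell f !=set0 -> cell f x.
  move=> f; have [[x xf]|nf] := pselect (cell f !=set0); first by exists x.
  by exists 0.
pose r := C * h ^+ n.+1.
have r0 : 0 <= r by rewrite mulr_ge0// exprn_ge0// ltW.
apply: (@covered_countable _ _ {ffun 'I_n -> 'I_m} [set f | cell f !=set0]
  (fun f => G (c f) - const_mx r) (fun f => G (c f) + const_mx r)).
  move=> _ [x Zx <-].
  have xh i : 0 <= (x 0 i - a 0 i) / h.
    by have /andP[? _] := Zbox x Zx i; apply: divr_ge0; [lra|exact: ltW].
  have im i : (Num.truncn ((x 0 i - a 0 i) / h)%R < m)%N.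
    rewrite truncn_lt_nat// ltr_pdivrMr// /h mulrC divfK ?gt_eqF//.
    by have /andP[_ ?] := Zbox x Zx i; lra.
  pose f := [ffun i => Ordinal (im i)].
  have fx : cell f x.
    split => // i; rewrite ffunE /=.
    have /andP[] := truncn_itv (xh i).
    rewrite ler_pdivlMr// ltr_pdivrMr// => h1 h2.
    by apply/andP; split; lra.
  have f0 : cell f !=set0 by exists x.
  exists f => // i; rewrite !mxE.
  have fc := cP f f0.
  have : `|(G x - G (c f)) 0 i| <= r.
    apply: le_trans (coord_le_norm _ _) _.
    apply: le_trans (flatG _ _ fc.1 Zx) _.
    apply: ler_wpM2l => //; apply: lerXn2r; rewrite ?nnegrE ?(ltW h0)//.
    exact: cell_norm fc fx.
  by rewrite !mxE ler_norml => /andP[? ?]; apply/andP; split; lra.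
under eq_esum do rewrite box_vol_cube//.
apply: le_trans (esum_const_le _ _) _; first by rewrite exprn_ge0// mulrn_wge0.
rewrite lee_fin card_ffun !card_ord natrX.
have rK : r *+ 2 * m%:R ^+ n.+1 = K.
  rewrite /r /K /h expr_div_n mulrnAl mulrA mulfVK//.
  by rewrite expf_neq0// gt_eqF.
have m1 : 1 <= m%:R ^+ n.+1 :> R by rewrite exprn_ege1// ler1n.
have mn0 : 0 < m%:R ^+ n :> R by rewrite exprn_gt0.
have r1 : r *+ 2 <= 1.
  have : r *+ 2 * m%:R <= m%:R.
    apply: (@le_trans _ _ K); last by lra.
    rewrite -rK ler_wpM2l ?mulrn_wge0// exprS ler_peMr ?(ltW m0)//.
    by rewrite exprn_ege1// ler1n.
  by rewrite ger_pMl.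
apply: (@le_trans _ _ (m%:R ^+ n * (r *+ 2))).
  rewrite ler_wpM2l ?(ltW mn0)// exprS ler_piMr ?mulrn_wge0//.
  by rewrite exprn_ile1// mulrn_wge0.
have -> : m%:R ^+ n * (r *+ 2) = K / m%:R.
  by rewrite -rK exprSr -mulrA mulfK ?gt_eqF// mulrC.
rewrite ler_pdivrMr//.
have : K / e <= m%:R by lra.
by rewrite ler_pdivrMr// mulrC.
Qed.

End Flat.

(** * Smooth scalar functions on R^n *)

Section Smooth.
Variables (R : realType) (n : nat).
Implicit Types (f g : 'rV[R]_n -> R) (x y v : 'rV[R]_n).

Definition basis (i : 'I_n) : 'rV[R]_n := delta_mx 0 i.

Definition pd (i : 'I_n) f : 'rV[R]_n -> R := fun x => 'D_(basis i) f x.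

Lemma is_derive_line f v y (t : R) : derivable f (t *: v + y) v ->
  is_derive t 1 (fun s : R => f (s *: v + y)) ('D_v f (t *: v + y)).
Proof.
have E : (fun h : R => h^-1 *:
      (((fun s : R => f (s *: v + y)) \o shift t) (h *: 1) - f (t *: v + y)))
    = (fun h : R => h^-1 *: ((f \o shift (t *: v + y)) (h *: v) - f (t *: v + y))).
  apply/funext => h /=; congr (_ *: (f _ - _)).
  by rewrite [h *: 1]mulr1 scalerDl addrA.
by move=> d; split; [rewrite /derivable E|rewrite /derive E].
Qed.

Lemma mvt_line f v y (s : R) : (forall z, derivable f z v) ->
  exists2 c : R, `|c| <= `|s| & f (s *: v + y) - f y = s * 'D_v f (c *: v + y).
Proof.
move=> df.
pose g (t : R) := f (t *: v + y).
have dg (t : R) : is_derive t 1 g ('D_v f (t *: v + y)) by exact: is_derive_line.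
have cg : continuous g.
  by move=> t; apply/differentiable_continuous/derivable1_diffP; case: (dg t).
have g0 : g 0 = f y by rewrite /g scale0r add0r.
have [s0|/ltW s0] := leP 0 s.
  have [c] := MVT_segment s0 (fun t _ => dg t) (continuous_subspaceT cg).
  rewrite in_itv /= => /andP[c0 cs] E; exists c; first by rewrite !ger0_norm.
  by rewrite -g0 -/(g s) E subr0 mulrC.
have [c] := MVT_segment s0 (fun t _ => dg t) (continuous_subspaceT cg).
rewrite in_itv /= => /andP[c0 cs] E; exists c.
  by rewrite !ler0_norm// lerN2.
by rewrite -g0 -/(g s) -opprB E sub0r mulrN opprK mulrC.
Qed.

Lemma row_sum_basis v : v = \sum_i v 0 i *: basis i.
Proof. exact: row_sum_delta. Qed.

(** The linear form with coefficients [a]; for [a = pd ^~ f x] it is the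
    differential of [f] at [x]. *)
Definition lform (a : 'I_n -> R) v : R := \sum_i v 0 i * a i.

Lemma lform_linear a : linear (lform a).
Proof.
move=> k u v; rewrite /lform scaler_sumr -big_split; apply: eq_bigr => i _ /=.
by rewrite !mxE mulrDl /GRing.scale /= mulrA.
Qed.

HB.instance Definition _ a :=
  GRing.isLinear.Build R 'rV[R]_n R *:%R (lform a) (lform_linear a).

Lemma lform_le a v (c : R) : (forall i, `|a i| <= c) ->
  `|lform a v| <= n%:R * c * `|v|.
Proof.
move=> ac; apply: le_trans (ler_norm_sum _ _ _) _.
apply: (@le_trans _ _ (\sum_(i < n) (c * `|v|))).
  apply: ler_sum => i _; rewrite normrM mulrC.
  by apply: ler_pM => //; exact: coord_le_norm.
by rewrite sumr_const card_ord mulr_natl -mulrnAl.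
Qed.

Lemma lform_continuous a : continuous (lform a).
Proof.
suff : continuous (fun v : 'rV[R]_n => \sum_(i < n) v 0 i * a i : R) by [].
apply: continuous_big; first exact: add_continuous.
move=> i _ x; apply: (@cvgM R _ (nbhs x) _ (fun v : 'rV[R]_n => v 0 i) (fun=> a i)).
  exact: coord_cvg.
exact: cvg_cst.
Qed.

(** Continuous partial derivatives give differentiability: going from [x] to
    [x + h] one coordinate at a time, the mean value theorem compares every
    increment with the partial derivative at a point close to [x]. *)
Lemma C1_differentiable f : (forall i x, derivable f x (basis i)) ->
  (forall i, continuous (pd i f)) -> forall x, differentiable f x.
Proof.
move=> df cf x.
pose L := lform (fun i => pd i f x).
have Lc : continuous L by exact: lform_continuous.
apply/diff_locallyP.
have aux (P Q : Prop) : (P -> Q) -> P -> Q /\ P by move=> PQ p; split=> //; exact: PQ.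
have [|-> ?] := aux _ _ (@diff_unique _ _ _ f L x Lc); last by split.
apply/eqaddoP => e e0.
pose e' := e / n.+1%:R.
have e'0 : 0 < e' by rewrite divr_gt0.
have : \forall y \near x, forall i, `|pd i f x - pd i f y| < e'.
  apply: (@filter_forall _ _ (fun i y => `|pd i f x - pd i f y| < e') (nbhs x)).
  by move=> i; move/cvgrPdist_lt : (cf i x); apply.
move=> /nbhs_ballP[d /= d0 dP].
apply/nbhs_ballP; exists d => // h; rewrite -ball_normE /= sub0r normrN => hd.
(* the k-th corner of the broken path from 0 to h *)
pose tr (k : nat) : 'rV[R]_n := \row_i (if (i < k)%N then h 0 i else 0).
have trS (i : 'I_n) : tr i.+1 = h 0 i *: basis i + tr i.
  apply/rowP => j; rewrite /basis !mxE eqxx ltnS leq_eqVlt /=.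
  have [->|ji] := eqVneq j i; first by rewrite eqxx mulr1 ltnn addr0.
  by rewrite val_eqE (negbTE ji) mulr0 add0r.
have step (i : 'I_n) : `|f (tr i.+1 + x) - f (tr i + x) - h 0 i * pd i f x| <= e' * `|h|.
  have [c ch E] := mvt_line (tr i + x) (h 0 i) (df i).
  rewrite trS -(addrA _ (tr i) x) E -mulrBr normrM mulrC.
  apply: ler_pM => //; last exact: coord_le_norm.
  rewrite distrC ltW//; apply: dP; rewrite -ball_normE /=.
  apply: le_lt_trans hd.
  rewrite addrA opprD addrCA subrr addr0 normrN.
  apply: mxnorm_le => // j; rewrite /basis !mxE eqxx /=.
  have [->|ji] := eqVneq j i.
    by rewrite mulr1 ltnn addr0; apply: le_trans ch (coord_le_norm _ _).
  rewrite mulr0 add0r; case: ifP => _; first exact: coord_le_norm.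
  by rewrite normr0.
have tr0 : tr 0%N = 0 by apply/rowP => j; rewrite !mxE.
have trn : tr n = h by apply/rowP => j; rewrite !mxE ltn_ord.
have -> : (f \o shift x - (cst (f x) + L)) h =
    \sum_(i < n) (f (tr i.+1 + x) - f (tr i + x) - h 0 i * pd i f x).
  rewrite sumrB -(big_mkord xpredT (fun i => f (tr i.+1 + x) - f (tr i + x))).
  rewrite telescope_sumr// trn tr0 add0r.
  by rewrite /L /lform !fctE /= opprD addrA.
apply: le_trans (ler_norm_sum _ _ _) _.
apply: le_trans (ler_sum _ (fun i _ => step i)) _.
rewrite sumr_const card_ord -mulrnAl ler_wpM2r//.
rewrite /e' -mulr_natr mulrAC ler_pdivrMr// ler_pM2l// ler_nat.
exact: leqnSn.
Qed.

Lemma derive_lform f x v : differentiable f x ->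
  'D_v f x = lform (fun i => pd i f x) v.
Proof.
move=> df; rewrite deriveE// {1}(row_sum_basis v) linear_sum.
apply: eq_bigr => i _; rewrite linearZ /=.
by rewrite /pd deriveE.
Qed.

Lemma mvt f x y : (forall z, differentiable f z) ->
  exists2 c : R, 0 <= c <= 1 &
    f y - f x = lform (fun i => pd i f (c *: (y - x) + x)) (y - x).
Proof.
move=> df; pose g (t : R) := f (t *: (y - x) + x).
have dg (t : R) : is_derive t 1 g ('D_(y - x) f (t *: (y - x) + x)).
  by apply: is_derive_line; exact: diff_derivable.
have cg : continuous g.
  by move=> t; apply/differentiable_continuous/derivable1_diffP; case: (dg t).
have [c] := MVT_segment ler01 (fun t _ => dg t) (continuous_subspaceT cg).
rewrite in_itv /= => c01 E; exists c => //.
move: E; rewrite subr0 mulr1 => E; rewrite -derive_lform// -E /g.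
by rewrite scale1r scale0r add0r subrK.
Qed.

(** Unlike the vector-valued [Ck], this class asks for differentiability at
    every order, so that closure under products follows from the Leibniz rule
    alone. *)
Fixpoint Cs (k : nat) f : Prop :=
  if k is k'.+1 then
    (forall x, differentiable f x) /\ forall i, Cs k' (pd i f)
  else continuous f.

Definition smooth_fn f := forall k, Cs k f.

Lemma CsS k f : Cs k.+1 f -> Cs k f.
Proof.
elim: k f => [|k IH] f; first by move=> [df _] /= x; exact/differentiable_continuous.
by move=> [df pf]; split => // i; apply: IH; exact: pf.
Qed.

Lemma Cs_cst k (c : R) : Cs k (cst c).
Proof.
elim: k c => [|k IH] c; first exact: cst_continuous.
split=> [x|i]; first exact: differentiable_cst.
suff -> : pd i (cst c) = cst 0 by apply: IH.
by apply/funext => x; exact: derive_cst.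
Qed.

Lemma CsD k f g : Cs k f -> Cs k g -> Cs k (f + g).
Proof.
elim: k f g => [|k IH] f g; first by move=> /= cf cg x; exact: (continuousD (cf x) (cg x)).
move=> [df pf] [dg pg]; split=> [x|i]; first exact: differentiableD.
suff -> : pd i (f + g) = pd i f + pd i g by apply: IH; [exact: pf|exact: pg].
by apply/funext => x; apply: deriveD; exact: diff_derivable.
Qed.

Lemma pdM i f g : (forall x, differentiable f x) -> (forall x, differentiable g x) ->
  pd i (f * g) = f * pd i g + g * pd i f.
Proof.
by move=> df dg; apply/funext => x; apply: deriveM; exact: diff_derivable.
Qed.

Lemma CsM k f g : Cs k f -> Cs k g -> Cs k (f * g).
Proof.
elim: k f g => [|k IH] f g; first by move=> /= cf cg x; exact: (continuousM (cf x) (cg x)).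
move=> Cf Cg; have [df pf] := Cf; have [dg pg] := Cg.
split=> [x|i]; first exact: differentiableM.
rewrite pdM//; apply: CsD; apply: IH.
- exact: CsS.
- exact: pg.
- exact: CsS.
- exact: pf.
Qed.

Lemma sm_continuous f : smooth_fn f -> continuous f.
Proof. exact: (fun s => s 0%N). Qed.

Lemma sm_diff f x : smooth_fn f -> differentiable f x.
Proof. by move=> s; have [] := s 1%N. Qed.

Lemma sm_pd i f : smooth_fn f -> smooth_fn (pd i f).
Proof. by move=> s k; exact: (s k.+1).2 i. Qed.

Lemma sm_cst c : smooth_fn (fun=> c).
Proof. by move=> k; exact: Cs_cst. Qed.

Lemma smD f g : smooth_fn f -> smooth_fn g -> smooth_fn (fun x => f x + g x).
Proof. by move=> sf sg k; exact: CsD (sf k) (sg k). Qed.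

Lemma smM f g : smooth_fn f -> smooth_fn g -> smooth_fn (fun x => f x * g x).
Proof. by move=> sf sg k; exact: CsM (sf k) (sg k). Qed.

Lemma sm_sum (I : Type) (r : seq I) (P : pred I) (F : I -> 'rV[R]_n -> R) :
  (forall i, smooth_fn (F i)) -> smooth_fn (fun x => \sum_(i <- r | P i) F i x).
Proof.
move=> sF; elim: r => [|i r IH].
  by under eq_fun do rewrite big_nil; exact: sm_cst.
under eq_fun do rewrite big_cons; case: (P i) => //; exact: smD.
Qed.

Lemma sm_prod (I : Type) (r : seq I) (P : pred I) (F : I -> 'rV[R]_n -> R) :
  (forall i, smooth_fn (F i)) -> smooth_fn (fun x => \prod_(i <- r | P i) F i x).
Proof.
move=> sF; elim: r => [|i r IH].
  by under eq_fun do rewrite big_nil; exact: sm_cst.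
under eq_fun do rewrite big_cons; case: (P i) => //; exact: smM.
Qed.

Definition sm_mx p q (M : 'rV[R]_n -> 'M[R]_(p, q)) := forall i j, smooth_fn (fun x => M x i j).

Lemma sm_cst_mx p q (A : 'M[R]_(p, q)) : sm_mx (fun=> A).
Proof. by move=> i j; exact: sm_cst. Qed.

Lemma sm_addmx p q (M N : 'rV[R]_n -> 'M[R]_(p, q)) :
  sm_mx M -> sm_mx N -> sm_mx (fun x => M x + N x).
Proof. by move=> sM sN i j; under eq_fun do rewrite mxE; exact: smD. Qed.

Lemma sm_mulmx p q r (M : 'rV[R]_n -> 'M[R]_(p, q)) (N : 'rV[R]_n -> 'M[R]_(q, r)) :
  sm_mx M -> sm_mx N -> sm_mx (fun x => M x *m N x).
Proof.
move=> sM sN i j; under eq_fun do rewrite mxE.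
by apply: sm_sum => k; exact: smM.
Qed.

Lemma sm_det p (M : 'rV[R]_n -> 'M[R]_p) : sm_mx M -> smooth_fn (fun x => \det (M x)).
Proof.
move=> sM; apply: sm_sum => s; apply: smM; first exact: sm_cst.
exact: sm_prod.
Qed.

Lemma sm_adj p (M : 'rV[R]_n -> 'M[R]_p) : sm_mx M -> sm_mx (fun x => \adj (M x)).
Proof.
move=> sM i j; under eq_fun do rewrite mxE.
apply: smM; first exact: sm_cst.
apply: sm_det => k l; under eq_fun do rewrite !mxE; exact: sM.
Qed.

End Smooth.

(** * Components of smooth maps, and Taylor estimates on balls *)

Section Link.
Variables (R : realType) (n m : nat).
Implicit Types F : 'rV[R]_n -> 'rV[R]_m.

Definition comp F (l : 'I_m) : 'rV[R]_n -> R := fun x => F x 0 l.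

Lemma comp_continuous F l : continuous F -> continuous (comp F l).
Proof. by move=> cF x; exact: (continuous_comp (cF x) (@coord_cvg _ _ l _)). Qed.

Lemma pd_comp F i l : (forall x, derivable F x (basis R i)) ->
  pd i (comp F l) = comp ('D_(basis R i) F) l.
Proof. by move=> dF; apply/funext => x; rewrite /comp derive_mx// mxE. Qed.

Lemma Cs_comp k F l : Ck k F -> Cs k (comp F l).
Proof.
elim: k F => [|k IH] F /= [cF]; first by move=> _; exact: comp_continuous.
move=> dF; have pF i x : derivable F x (basis R i) by exact: (dF i).1.
split=> [x|i]; last by rewrite pd_comp//; apply: IH; exact: (dF i).2.
apply: C1_differentiable => i.
  by move=> y; exact: ((derivable_mxP _ _ _).1 (pF i y)).
rewrite pd_comp//; apply: comp_continuous.
by have [_] := dF i; case: (k) => [|k'] [].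
Qed.

Lemma sm_comp F l : smooth F -> smooth_fn (comp F l).
Proof. by move=> sF k; exact: Cs_comp. Qed.

Lemma smooth_differentiable F x : smooth F -> differentiable F x.
Proof.
move=> sF.
have -> : F = \sum_(l < m) (fun y => comp F l y *: basis R l).
  by apply/funext => y; rewrite fct_sumE; exact: row_sum_delta.
apply: differentiable_sum => l; apply: differentiableZl.
exact: sm_diff (sm_comp l sF).
Qed.

Lemma jacobianE F x i l : smooth F -> 'J F x i l = pd i (comp F l) x.
Proof.
move=> sF; have dF := fun y => smooth_differentiable y sF.
rewrite pd_comp; last by move=> y; exact: diff_derivable.
by rewrite /comp deriveEjacobian// /basis -rowE [RHS]mxE.
Qed.

End Link.

Section Taylor.
Variables (R : realType) (n : nat).
Implicit Types (f : 'rV[R]_n -> R) (x y : 'rV[R]_n).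

Definition cball x0 (r : R) : set 'rV[R]_n := [set x | `|x - x0| <= r].

Lemma cball_convex x0 r x y (c : R) : 0 <= c <= 1 ->
  cball x0 r x -> cball x0 r y -> cball x0 r (c *: (y - x) + x).
Proof.
move=> /andP[c0 c1] xr yr; rewrite /cball /=.
have -> : c *: (y - x) + x - x0 = c *: (y - x0) + (1 - c) *: (x - x0).
  by apply/rowP => i; rewrite !mxE; ring.
apply: le_trans (ler_normD _ _) _; rewrite !normrZ !ger0_norm ?subr_ge0//.
have -> : r = c * r + (1 - c) * r by ring.
by apply: lerD; apply: ler_wpM2l; rewrite ?subr_ge0.
Qed.

Lemma cball_compact x0 r : compact (cball x0 r).
Proof.
apply: bounded_closed_compact.
  exists (r + `|x0|); split; first exact: num_real.
  move=> M rM x xr; apply: le_trans (ltW rM).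
  by rewrite -(subrK x0 x); apply: le_trans (ler_normD _ _) _; rewrite lerD2r.
have -> : cball x0 r = (fun x => `|x - x0|) @^-1` [set t | t <= r] by [].
apply: (@closed_comp _ _ (fun x : 'rV[R]_n => `|x - x0|)); last exact: closed_le.
move=> x _; apply: (@cvg_norm _ _ _ (nbhs x) _ (fun x : 'rV[R]_n => x - x0)).
apply: (@cvgB _ _ _ (nbhs x) _ id (cst x0)); [exact: cvg_id|exact: cst_continuous].
Qed.

Lemma sm_bounded f x0 r : smooth_fn f ->
  exists2 C : R, 0 < C & forall x, cball x0 r x -> `|f x| <= C.
Proof.
move=> sf.
have : compact (f @` cball x0 r).
  apply: continuous_compact; last exact: cball_compact.
  by apply: continuous_subspaceT; exact: sm_continuous.
move=> /compact_bounded/ex_strict_bound_gt0[C C0 CP].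
by exists C => // x xr; apply/ltW/CP; exists x.
Qed.

(** Finitely many bounds can be replaced by a common one; the sum of the bounds
    is easier to handle than their maximum. *)
Lemma finite_bound (I : finType) (P : I -> R -> Prop) :
  (forall i, exists2 C : R, 0 < C & P i C) ->
  (forall i C D, C <= D -> P i C -> P i D) ->
  exists2 C : R, 0 < C & forall i, P i C.
Proof.
move=> exC mono.
have /choice[c cP] : forall i, exists C, 0 < C /\ P i C.
  by move=> i; have [C ? ?] := exC i; exists C.
exists (1 + \sum_i c i).
  by rewrite ltr_pwDl// sumr_ge0// => i _; exact: ltW (cP i).1.
move=> i; apply: mono (cP i).2.
rewrite (bigD1 i)//= addrCA lerDl addr_ge0// sumr_ge0// => j _.
exact: ltW (cP j).1.
Qed.

Lemma sm_mx_bounded p q (M : 'rV[R]_n -> 'M[R]_(p, q)) x0 r : sm_mx M ->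
  exists2 C : R, 0 < C & forall x, cball x0 r x -> forall i j, `|M x i j| <= C.
Proof.
move=> sM.
have [||C C0 CP] := @finite_bound ('I_p * 'I_q)%type
  (fun ij C => forall x, cball x0 r x -> `|M x ij.1 ij.2| <= C).
- by move=> [i j]; exact: sm_bounded (sM i j).
- by move=> ij C D CD CP x /CP/le_trans; apply.
by exists C => // x xr i j; exact: (CP (i, j)).
Qed.

Lemma sm_lip f x0 r : smooth_fn f -> exists2 C : R, 0 < C &
  forall x y, cball x0 r x -> cball x0 r y -> `|f y - f x| <= C * `|y - x|.
Proof.
move=> sf; have [||C C0 CP] := @finite_bound 'I_n
  (fun i C => forall x, cball x0 r x -> `|pd i f x| <= C).
- by move=> i; exact: sm_bounded (sm_pd i sf).
- by move=> i C D CD CP x /CP/le_trans; apply.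
exists (n.+1%:R * C); first by rewrite mulr_gt0.
move=> x y xr yr; have [c c01 ->] := mvt x y (fun z => sm_diff z sf).
apply: le_trans (lform_le _ (c := C) _) _.
  by move=> i; apply: CP; exact: cball_convex.
by rewrite ler_wpM2r// ler_wpM2r ?(ltW C0)// ler_nat.
Qed.

(** The mean value theorem, together with the Lipschitz bound for the partial
    derivatives, which are themselves smooth. *)
Lemma sm_taylor f x0 r : smooth_fn f -> exists2 C : R, 0 < C &
  forall x y, cball x0 r x -> cball x0 r y ->
  `|f y - f x - lform (fun i => pd i f x) (y - x)| <= C * `|y - x| ^+ 2.
Proof.
move=> sf; have [||C C0 CP] := @finite_bound 'I_n
  (fun i C => forall x y, cball x0 r x -> cball x0 r y ->
     `|pd i f y - pd i f x| <= C * `|y - x|).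
- by move=> i; exact: sm_lip (sm_pd i sf).
- move=> i C D CD CP x y xr yr; apply: le_trans (CP x y xr yr) _.
  by rewrite ler_wpM2r.
exists (n.+1%:R * C); first by rewrite mulr_gt0.
move=> x y xr yr; have [c c01 ->] := mvt x y (fun z => sm_diff z sf).
set z := c *: (y - x) + x.
have zr : cball x0 r z by exact: cball_convex.
have -> : lform (fun i => pd i f z) (y - x) - lform (fun i => pd i f x) (y - x)
    = lform (fun i => pd i f z - pd i f x) (y - x).
  by rewrite /lform -sumrB; apply: eq_bigr => i _; rewrite mulrBr.
apply: le_trans (lform_le _ (c := C * `|y - x|) _) _.
  move=> i; apply: le_trans (CP i x z xr zr) _; rewrite ler_wpM2l ?(ltW C0)//.
  rewrite /z addrK normrZ ler_piMl//.
  by case/andP: c01 => c0 c1; rewrite ger0_norm.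
rewrite expr2 !mulrA ler_wpM2r// ler_wpM2r// ler_wpM2r ?(ltW C0)//.
by rewrite ler_nat.
Qed.

End Taylor.

(** * Tangent vector fields of a regular level set *)

Section Frame.
Variable R : realType.

(** Gaussian elimination provides coordinates in which the injective matrix [A]
    is the standard inclusion. There [A *m L] and [K] act on complementary
    coordinates, so that their sum is invertible, and [C] is the projection
    along the first ones. The matrix [Q] records that [L] is injective on rows
    while [K] and [C] vanish on the range of [Q]. All four are constant, so
    they keep their properties when [A] is replaced by the gradients at another
    point. *)
Lemma tangent_frame n p (A : 'M[R]_(n, p)) : \rank A = p ->
  exists (L : 'M[R]_(p, n)) (K C : 'M[R]_n) (Q : 'M[R]_(n, p)),
    [/\ A *m L + K \in unitmx, L *m Q = 1%:M, K *m Q = 0, C *m Q = 0 & K *m C = K].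
Proof.
move=> rA.
have pn : (p <= n)%N by rewrite -rA rank_leq_row.
have defA := mulmx_ebase A; rewrite rA in defA.
set U := col_ebase A in defA; set V := row_ebase A in defA.
have Uu : U \in unitmx by exact: col_ebase_unit.
have Vu : V \in unitmx by exact: row_ebase_unit.
exists (invmx V *m pid_mx p), (U *m copid_mx p), (copid_mx p), (pid_mx p *m V).
have copid_pid : copid_mx p *m pid_mx p = 0 :> 'M[R]_(n, p).
  exact: mul_copid_mx_pid.
split.
- rewrite -{1}defA mulmxA mulmxK// -mulmxA mul_pid_mx !minnn -mulmxDr.
  by rewrite /copid_mx addrC subrK mulmx1.
- rewrite mulmxA -(mulmxA (invmx V)) mul_pid_mx !minnn (minn_idPr pn) pid_mx_1 mulmx1.
  by rewrite mulVmx.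
- by rewrite mulmxA -(mulmxA U) copid_pid mulmx0 mul0mx.
- by rewrite mulmxA copid_pid mul0mx.
- by rewrite -mulmxA copid_mx_id.
Qed.

Section Fields.
Variables (n p : nat) (F : 'I_p -> 'rV[R]_n -> R).
Hypothesis smF : forall l, smooth_fn (F l).
Variables (L : 'M[R]_(p, n)) (K C : 'M[R]_n) (Q : 'M[R]_(n, p)).
Hypotheses (LQ : L *m Q = 1%:M) (KQ : K *m Q = 0) (CQ : C *m Q = 0).

Definition grads q (G : 'I_q -> 'rV[R]_n -> R) (x : 'rV[R]_n) : 'M[R]_(n, q) :=
  \matrix_(i, l) pd i (G l) x.

Lemma sm_grads q (G : 'I_q -> 'rV[R]_n -> R) : (forall l, smooth_fn (G l)) -> sm_mx (grads G).
Proof. by move=> sG i l; under eq_fun do rewrite mxE; exact: sm_pd. Qed.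

(** The differential of the map [x |-> F x *m L + x *m K], which is a local
    chart around the point where [L] and [K] have been chosen: up to a linear
    change, the constraints [F] are some of its coordinates, and the others are
    linear. *)
Definition frame x : 'M[R]_n := grads F x *m L + K.
Definition fdet x : R := \det (frame x).
(** The rows of this matrix are vector fields, tangent to all the level sets of
    [F]. They are [fdet] times the fields with constant coordinates, the rows
    of [C], in the chart; using the adjugate instead of the inverse makes them
    polynomial in the derivatives of [F], hence defined and smooth on the whole
    space. *)
Definition tangent x : 'M[R]_n := C *m \adj (frame x).

Lemma sm_frame : sm_mx frame.
Proof.
apply: sm_addmx; last exact: sm_cst_mx.
by apply: sm_mulmx; [exact: sm_grads|exact: sm_cst_mx].
Qed.

Lemma sm_fdet : smooth_fn fdet.
Proof. exact: sm_det sm_frame. Qed.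

Lemma sm_tangent : sm_mx tangent.
Proof. by apply: sm_mulmx; [exact: sm_cst_mx|apply: sm_adj; exact: sm_frame]. Qed.

Lemma tangent_frameE x : tangent x *m frame x = fdet x *: C.
Proof. by rewrite -mulmxA mul_adj_mx mul_mx_scalar. Qed.

(** The adjugate identity gives [tangent x *m frame x = fdet x *: C]; on the
    range of [Q] the right-hand side vanishes and [frame x] reduces to the
    gradients of [F]. *)
Lemma tangent_grads x : tangent x *m grads F x = 0.
Proof.
have /(congr1 (mulmx^~ Q)) := tangent_frameE x.
rewrite -mulmxA mulmxDl KQ addr0 -(mulmxA (grads F x)) LQ mulmx1.
by rewrite -scalemxAl CQ scaler0.
Qed.

Lemma tangent_K x : tangent x *m K = fdet x *: C.
Proof.
by rewrite -tangent_frameE /frame mulmxDr (mulmxA (tangent x)) tangent_grads mul0mx add0r.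
Qed.

(** The derivative of [f] along the [i]-th tangent field. It is again a smooth
    function on the whole space, and can therefore be iterated or serve as a
    constraint. *)
Definition tder (i : 'I_n) (f : 'rV[R]_n -> R) : 'rV[R]_n -> R :=
  fun x => \sum_k tangent x i k * pd k f x.

Lemma sm_tder i f : smooth_fn f -> smooth_fn (tder i f).
Proof.
by move=> sf; apply: sm_sum => k; apply: smM; [exact: sm_tangent|exact: sm_pd].
Qed.

Lemma tder_constraint i l : tder i (F l) = fun=> 0.
Proof.
apply/funext => x; have /matrixP/(_ i l) := tangent_grads x.
by rewrite mxE [RHS]mxE => E; rewrite -[RHS]E; apply: eq_bigr => k _; rewrite [grads _ _ _ _]mxE.
Qed.

(** Tangential derivatives do not see the gradients of the constraints, so a
    linear relation modulo these gradients is inherited by the tangential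
    derivatives. *)
Lemma tder_grads i q (G : 'I_q -> 'rV[R]_n -> R) x (a : 'cV[R]_p) (c : 'cV[R]_q) :
  grads F x *m a + grads G x *m c = 0 -> \sum_j tder i (G j) x * c j 0 = 0.
Proof.
move=> /(congr1 (mulmx (tangent x))).
rewrite mulmxDr mulmxA tangent_grads mul0mx add0r mulmx0 mulmxA.
move=> /matrixP/(_ i 0); rewrite mxE [RHS]mxE => E; rewrite -[RHS]E.
apply: eq_bigr => j _; rewrite [(_ *m _) i j]mxE; congr (_ * _).
by apply: eq_bigr => k _; rewrite [grads _ _ _ _]mxE.
Qed.

Definition tders (w : seq 'I_n) f := foldr tder f w.

Lemma sm_tders w f : smooth_fn f -> smooth_fn (tders w f).
Proof. by move=> sf; elim: w => //= i w; exact: sm_tder. Qed.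

(** All the iterated tangential derivatives, of order at least one, vanish: [f]
    is constant up to any order along the level set of [F]. *)
Definition flat f (x : 'rV[R]_n) := forall w, w != [::] -> tders w f x = 0.

Lemma flat_tder i f x : flat f x -> flat (tder i f) x /\ tder i f x = 0.
Proof.
move=> fl; split; last exact: (fl [:: i]).
by move=> w _; rewrite -[tders w _]/(foldr tder (tder i f) w) -foldr_rcons; apply: fl; case: w.
Qed.

Lemma lform_tangent f x (s : 'rV[R]_n) :
  lform (fun k => pd k f x) (s *m tangent x) = \sum_i s 0 i * tder i f x.
Proof.
rewrite /lform; under eq_bigr do rewrite mxE mulr_suml.
rewrite exchange_big; apply: eq_bigr => i _ /=.
by rewrite /tder mulr_sumr; apply: eq_bigr => k _; rewrite mulrA.
Qed.

End Fields.
End Frame.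

(** * Flat functions along a level set *)

Section FlatEstimate.
Variables (R : realType) (n p : nat) (F : 'I_p -> 'rV[R]_n -> R).
Hypothesis smF : forall l, smooth_fn (F l).
Variables (L : 'M[R]_(p, n)) (K C : 'M[R]_n) (Q : 'M[R]_(n, p)).
Hypotheses (LQ : L *m Q = 1%:M) (KQ : K *m Q = 0) (CQ : C *m Q = 0).

Local Notation W := (frame F L K).
Local Notation D := (fdet F L K).
Local Notation T := (tangent F L K C).

Lemma mulmx_norm_le m q (s : 'rV[R]_m) (M : 'M[R]_(m, q)) (B : R) : 0 <= B ->
  (forall i j, `|M i j| <= B) -> `|s *m M| <= m%:R * B * `|s|.
Proof.
move=> B0 MB; apply: mxnorm_le => [|j]; first by rewrite !mulr_ge0.
by rewrite mxE; apply: (@lform_le R m (fun i => M i j)).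
Qed.

Lemma fdet_lower x0 : D x0 != 0 -> exists2 r : R, 0 < r &
  exists2 c : R, 0 < c & forall x, cball x0 r x -> c <= `|D x|.
Proof.
move=> D0; have c0 : 0 < `|D x0| / 2 by rewrite divr_gt0// normr_gt0.
have cD := sm_continuous (sm_fdet smF L K).
have := cD x0; move=> /cvgrPdist_lt/(_ _ c0)/nbhs_ballP[r /= r0 rP].
exists (r / 2); first by rewrite divr_gt0.
exists (`|D x0| / 2) => // x xr.
have : `|D x0 - D x| < `|D x0| / 2.
  apply: rP; rewrite -ball_normE /= distrC (le_lt_trans xr)//.
  by rewrite ltr_pdivrMr// ltr_pMr// ltr1n.
have := lerB_dist (D x0) (D x); lra.
Qed.

Lemma sum_incr (a : nat -> R) (b : R) N : 0 <= b ->
  (forall i, (i < N)%N -> `|a i.+1 - a i| <= b) ->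
  forall i, (i <= N)%N -> `|a i - a 0%N| <= N%:R * b.
Proof.
move=> b0 ab i iN; apply: (@le_trans _ _ (i%:R * b)); last first.
  by rewrite ler_wpM2r// ler_nat.
elim: i iN => [|i IH] iN; first by rewrite subrr normr0 mul0r.
rewrite -(subrKA (a i)); apply: le_trans (ler_normD _ _) _.
by rewrite -natr1 mulrDl mul1r addrC lerD ?ab//; apply: IH; exact: ltnW.
Qed.

Section Local.
Variables (x0 : 'rV[R]_n) (r c : R).
Hypotheses (r0 : 0 < r) (c0 : 0 < c) (Dc : forall x, cball x0 r x -> c <= `|D x|).

(** One step of the Euler method for the flow of a combination of the tangent
    fields; on the linear coordinates [x *m K] it is the translation by
    [s *m C]. It leaves the level set of [F], but by an error of second order
    only, so that the discrete path can replace a true path on the level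
    set. *)
Definition step (s x : 'rV[R]_n) : 'rV[R]_n := x + (D x)^-1 *: (s *m T x).

Lemma D_neq0 x : cball x0 r x -> D x != 0.
Proof. by move=> /Dc cD; rewrite -normr_gt0 (lt_le_trans c0). Qed.

Lemma Dinv_le x (a b : R) : cball x0 r x -> `|a| <= b -> `|(D x)^-1 * a| <= c^-1 * b.
Proof.
move=> xr ab; rewrite normrM normfV; apply: ler_pM => //.
by rewrite lef_pV2 ?Dc// posrE// (lt_le_trans c0)// Dc.
Qed.

Lemma step_size : exists2 Lam : R, 0 < Lam &
  forall s x, cball x0 r x -> `|step s x - x| <= Lam * `|s|.
Proof.
have [B B0 BP] := sm_mx_bounded x0 r (sm_tangent smF L K C).
exists (c^-1 * (n.+1%:R * B)); first by rewrite !mulr_gt0// invr_gt0.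
move=> s x xr; rewrite /step addrAC subrr add0r normrZ.
have := @Dinv_le x `|s *m T x| (n.+1%:R * B * `|s|) xr.
rewrite normrM !normr_id mulrA; apply.
apply: le_trans (mulmx_norm_le s (ltW B0) (BP x xr)) _.
by rewrite ler_wpM2r// ler_wpM2r ?(ltW B0)// ler_nat.
Qed.

(** Taylor expansion to second order; the first-order term only involves
    tangential derivatives because the step is a combination of tangent
    fields. *)
Lemma step_incr f : smooth_fn f -> exists2 B : R, 0 < B & forall s x,
  cball x0 r x -> cball x0 r (step s x) ->
  `|f (step s x) - f x - (D x)^-1 * \sum_i s 0 i * tder F L K C i f x| <= B * `|s| ^+ 2.
Proof.
move=> sf; have [B B0 BP] := sm_taylor x0 r sf.
have [Lam Lam0 LamP] := step_size.
exists (B * Lam ^+ 2); first by rewrite mulr_gt0// exprn_gt0.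
move=> s x xr sr; rewrite -lform_tangent.
have -> : (D x)^-1 * lform (fun k => pd k f x) (s *m T x) =
    lform (fun k => pd k f x) (step s x - x).
  by rewrite /step addrAC subrr add0r linearZ.
apply: le_trans (BP x (step s x) xr sr) _.
rewrite -mulrA -exprMn ler_wpM2l ?(ltW B0)//.
by rewrite lerXn2r ?nnegrE ?mulr_ge0 ?(ltW Lam0)//; exact: LamP.
Qed.

Section Chain.
Variable Lam : R.
Hypotheses (Lam0 : 0 < Lam)
  (LamP : forall s x, cball x0 r x -> `|step s x - x| <= Lam * `|s|).

Local Notation chain s x k := (iter k (step s) x).

Lemma cball_half x : cball x0 (r / 2) x -> cball x0 r x.
Proof. by rewrite /cball /= => /le_trans; apply; rewrite ler_pdivrMr// ler_peMr ?ler1n// ltW. Qed.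

Lemma chain_in s x N : cball x0 (r / 2) x -> Lam * (N%:R * `|s|) <= r / 2 ->
  forall k, (k <= N)%N ->
  cball x0 r (chain s x k) /\ `|chain s x k - x| <= k%:R * (Lam * `|s|).
Proof.
move=> xr Ns; elim=> [|k IH] kN; first by rewrite subrr normr0 mul0r; split => //; exact: cball_half.
have [kr kx] := IH (ltnW kN).
have kS : `|chain s x k.+1 - x| <= k.+1%:R * (Lam * `|s|).
  rewrite -(subrKA (chain s x k)); apply: le_trans (ler_normD _ _) _.
  by rewrite -natr1 mulrDl mul1r addrC lerD// LamP.
split => //; rewrite /cball /= -(subrKA x); apply: le_trans (ler_normD _ _) _.
rewrite [leRHS]splitr lerD//; apply: le_trans kS (le_trans _ Ns).
by rewrite mulrCA ler_wpM2l ?(ltW Lam0)// ler_wpM2r// ler_nat.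
Qed.

(** Up to a constant, [N * |s|] bounds the length of the path and [|s|] its
    mesh. The tangential derivatives of [f] are flat as well and vanish at [x];
    summing the increments of [f] gains one power of the length over the bound
    that the induction hypothesis gives for them. The last term collects the
    [N] second-order errors of the Euler method; it disappears when the mesh
    tends to 0. *)
Lemma flat_chain k f : smooth_fn f -> exists2 B : R, 0 < B & forall x s N,
  cball x0 (r / 2) x -> flat F L K C f x ->
  Lam * (N%:R * `|s|) <= r / 2 -> N%:R * `|s| <= 1 ->
  forall i, (i <= N)%N -> `|f (chain s x i) - f x| <=
    B * ((N%:R * `|s|) ^+ k.+1 + N%:R * `|s| * `|s|).
Proof.
elim: k f => [|k IH] f sf.
  have [B B0 BP] := sm_lip x0 r sf.
  exists (B * Lam); first by rewrite mulr_gt0.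
  move=> x s N xr _ Ns _ i iN; have [ir ix] := chain_in xr Ns iN.
  apply: le_trans (BP _ _ (cball_half xr) ir) _.
  rewrite -mulrA ler_wpM2l ?(ltW B0)//; apply: le_trans ix _.
  rewrite mulrCA ler_wpM2l ?(ltW Lam0)// expr1 -[leLHS]addr0.
  by rewrite lerD ?ler_wpM2r ?ler_nat// !mulr_ge0.
have [||A A0 AP] := @finite_bound R 'I_n (fun j B => forall x s N,
  cball x0 (r / 2) x -> flat F L K C (tder F L K C j f) x ->
  Lam * (N%:R * `|s|) <= r / 2 -> N%:R * `|s| <= 1 ->
  forall i, (i <= N)%N -> `|tder F L K C j f (chain s x i) - tder F L K C j f x| <=
    B * ((N%:R * `|s|) ^+ k.+1 + N%:R * `|s| * `|s|)).
- by move=> j; apply: IH; exact: sm_tder.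
- move=> j a b ab aP x s N xr fl Ns N1 i iN; apply: le_trans (aP x s N xr fl Ns N1 i iN) _.
  by rewrite ler_wpM2r// addr_ge0// ?exprn_ge0 ?mulr_ge0.
have [B B0 BP] := step_incr sf.
exists (c^-1 * (n.+1%:R * A) + B).
  by rewrite addr_gt0// !mulr_gt0// invr_gt0.
move=> x s N xr fl Ns N1 i iN.
set t := N%:R * `|s|; set h := `|s|.
have t0 : 0 <= t by rewrite mulr_ge0.
have h0 : 0 <= h by exact: normr_ge0.
pose a m := f (chain s x m).
pose b := h * (c^-1 * (n.+1%:R * A) * (t ^+ k.+1 + t * h)) + B * h ^+ 2.
have b0 : 0 <= b.
  by rewrite addr_ge0// !mulr_ge0 ?addr_ge0 ?exprn_ge0 ?mulr_ge0 ?(ltW A0) ?(ltW B0)// invr_ge0 ltW.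
have ab m : (m < N)%N -> `|a m.+1 - a m| <= b.
  move=> mN; have [mr _] := chain_in xr Ns (ltnW mN).
  have [Sr _] := chain_in xr Ns mN.
  have := BP s (chain s x m) mr Sr.
  set S := \sum_i _ => le2.
  have le1 : `|S| <= n.+1%:R * (A * (t ^+ k.+1 + t * h)) * h.
    apply: le_trans (lform_le _ (c := A * (t ^+ k.+1 + t * h)) _) _.
      move=> j; have [flj Xj] := flat_tder j fl.
      rewrite -[X in `|X|]subr0 -Xj.
      exact: AP flj Ns N1 _ (ltnW mN).
    rewrite ler_wpM2r// ler_wpM2r ?ler_nat//.
    by rewrite !mulr_ge0 ?addr_ge0 ?exprn_ge0 ?mulr_ge0 ?(ltW A0).
  have := Dinv_le mr le1 => {}le1.
  rewrite -(subrK ((D (chain s x m))^-1 * S) (a m.+1 - a m)).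
  apply: le_trans (ler_normD _ _) _; rewrite /b addrC lerD//.
  by apply: le_trans le1 _; rewrite le_eqVlt; apply/orP; left; apply/eqP; ring.
apply: le_trans (sum_incr b0 ab iN) _.
rewrite /b mulrDr [N%:R * (h * _)]mulrA -/t.
have -> : N%:R * (B * h ^+ 2) = B * (t * h) by rewrite /t -/h; ring.
rewrite mulrDl; apply: lerD.
  rewrite mulrCA ler_wpM2l//; first by rewrite !mulr_ge0 ?(ltW A0)// invr_ge0 ltW.
  rewrite mulrDr -exprS lerD2l mulrA ler_wpM2r// -[leRHS]mulr1.
  by rewrite ler_wpM2l.
rewrite ler_wpM2l ?(ltW B0)// lerDr exprn_ge0//.
Qed.

(** The tangential derivatives of a constraint are identically 0, so only the
    second-order errors remain. *)
Lemma F_chain : exists2 B : R, 0 < B & forall l x s N,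
  cball x0 (r / 2) x -> Lam * (N%:R * `|s|) <= r / 2 ->
  `|F l (chain s x N) - F l x| <= B * (N%:R * `|s| * `|s|).
Proof.
have [||B B0 BP] := @finite_bound R 'I_p (fun l B => forall s x,
  cball x0 r x -> cball x0 r (step s x) ->
  `|F l (step s x) - F l x| <= B * `|s| ^+ 2).
- move=> l; have [B B0 BP] := step_incr (smF l); exists B => // s x xr sr.
  have := BP s x xr sr; rewrite big1 ?mulr0 ?subr0// => i _.
  by rewrite (tder_constraint F LQ KQ CQ) mulr0.
- move=> l a b ab aP s x xr sr; apply: le_trans (aP s x xr sr) _.
  by rewrite ler_wpM2r// exprn_ge0.
exists B => // l x s N xr Ns.
have := @sum_incr (fun m => F l (chain s x m)) (B * `|s| ^+ 2) N.
have -> : N%:R * (B * `|s| ^+ 2) = B * (N%:R * `|s| * `|s|) by ring.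
apply => //; first by rewrite mulr_ge0 ?exprn_ge0 ?(ltW B0).
move=> i iN; have [ir _] := chain_in xr Ns (ltnW iN).
have [Sr _] := chain_in xr Ns iN; exact: BP.
Qed.

(** The linear coordinates [x *m K] of the chart are followed exactly. *)
Lemma chain_K s x N : s *m C = s -> cball x0 (r / 2) x ->
  Lam * (N%:R * `|s|) <= r / 2 ->
  chain s x N *m K = x *m K + N%:R *: s.
Proof.
move=> sC xr Ns; suff : forall k, (k <= N)%N -> chain s x k *m K = x *m K + k%:R *: s.
  by apply.
elim=> [|k IH] kN; first by rewrite scale0r addr0.
have [kr _] := chain_in xr Ns (ltnW kN).
rewrite /= {1}/step mulmxDl IH; last exact: ltnW.
rewrite -scalemxAl -mulmxA (tangent_K _ LQ KQ CQ) -scalemxAr sC scalerA.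
by rewrite mulVf ?D_neq0// -addrA -scalerDl natr1.
Qed.

End Chain.

(** The quantitative injectivity of the chart: two close points with the same
    linear coordinates are no further apart than the values of the constraints.
    Writing [z - y] through the inverse of the frame gives
    [|v| <= B (e + A |v|^2)], and for small [|v|] the quadratic term is
    absorbed by the left-hand side. *)
Lemma transverse : exists2 B : R, 0 < B & exists2 d : R, 0 < d & forall y z (e : R),
  cball x0 r y -> cball x0 r z -> (z - y) *m K = 0 -> `|z - y| <= d -> 0 <= e ->
  (forall l, `|F l z - F l y| <= e) -> `|z - y| <= B * e.
Proof.
have [||A A0 AP] := @finite_bound R 'I_p (fun l A => forall x y,
  cball x0 r x -> cball x0 r y ->
  `|F l y - F l x - lform (fun i => pd i (F l) x) (y - x)| <= A * `|y - x| ^+ 2).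
- by move=> l; exact: sm_taylor.
- move=> l a b ab aP x y xr yr; apply: le_trans (aP x y xr yr) _.
  by rewrite ler_wpM2r// exprn_ge0.
have sLW : sm_mx (fun x => L *m \adj (W x)).
  by apply: sm_mulmx; [exact: sm_cst_mx|apply: sm_adj; exact: sm_frame].
have [M M0 MP] := sm_mx_bounded x0 r sLW.
pose B := c^-1 * (p.+1%:R * M).
have B0 : 0 < B by rewrite !mulr_gt0// invr_gt0.
exists (B *+ 2); first by rewrite mulrn_wgt0.
exists ((B * A *+ 2)^-1); first by rewrite invr_gt0 mulrn_wgt0// mulr_gt0.
move=> y z e yr zr; set v := z - y => vK vd e0 Fe.
pose u : 'rV[R]_p := \row_l lform (fun i => pd i (F l) y) v.
have uE : v *m grads F y = u.
  by apply/rowP => l; rewrite !mxE; apply: eq_bigr => i _; rewrite !mxE.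
have vE : v = (D y)^-1 *: (u *m (L *m \adj (W y))).
  rewrite -uE mulmxA; have -> : v *m grads F y *m L = v *m W y.
    by rewrite /frame mulmxDr vK addr0 mulmxA.
  by rewrite -mulmxA mul_mx_adj mul_mx_scalar scalerA mulVf ?scale1r// D_neq0.
have ue : `|u| <= e + A * `|v| ^+ 2.
  apply: mxnorm_le => [|l]; first by rewrite addr_ge0// mulr_ge0 ?(ltW A0)// exprn_ge0.
  rewrite mxE; have := AP l y z yr zr; rewrite -/v => AP'.
  rewrite -(subrK (F l z - F l y) (lform _ _)) addrC.
  by apply: le_trans (ler_normD _ _) _; rewrite lerD// distrC.
have : `|v| <= B * (e + A * `|v| ^+ 2).
  rewrite {1}vE normrZ -mulrA.
  have := @Dinv_le y `|u *m (L *m \adj (W y))| (p.+1%:R * M * (e + A * `|v| ^+ 2)) yr.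
  rewrite normrM !normr_id mulrA; apply.
  apply: le_trans (mulmx_norm_le u (ltW M0) (MP y yr)) _.
  apply: ler_pM => //; first by rewrite mulr_ge0// ltW.
  by rewrite ler_wpM2r ?(ltW M0)// ler_nat.
have BA : 0 < B * A *+ 2 by rewrite mulrn_wgt0// mulr_gt0.
have : B * A *+ 2 * `|v| <= 1.
  by rewrite -ler_pdivlMl// mulr1.
have v0 : 0 <= `|v| by exact: normr_ge0.
move=> h1 h2; have := ler_wpM2r v0 h1; rewrite expr2 in h2; lra.
Qed.

End Local.

Lemma le_inv_succ (a b A : R) : 0 <= A -> (forall N : nat, a <= b + A / N.+1%:R) -> a <= b.
Proof.
move=> A0 H; apply/ler_addgt0Pr => e e0.
apply: le_trans (H (Num.truncn (A / e))) _; rewrite lerD2l ler_pdivrMr// mulrC.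
by rewrite -ler_pdivrMr//; apply/ltW/truncnS_gt.
Qed.

End FlatEstimate.

Section FlatLocal.
Variables (R : realType) (n p : nat) (F : 'I_p -> 'rV[R]_n -> R).
Hypothesis smF : forall l, smooth_fn (F l).
Variables (L : 'M[R]_(p, n)) (K C : 'M[R]_n) (Q : 'M[R]_(n, p)).
Hypotheses (LQ : L *m Q = 1%:M) (KQ : K *m Q = 0) (CQ : C *m Q = 0) (KC : K *m C = K).

(** If [f] is flat at [x], the point [y] of the same level set is compared with
    the end point [z] of the Euler path that starts at [x] and has the linear
    coordinates of [y] as its target. The values of [F] at [z] and [y] differ
    by the error of the Euler method, hence so do [z] and [y]; letting the
    number of steps tend to infinity leaves the estimate of [flat_chain]. *)
Theorem flat_estimate x0 : fdet F L K x0 != 0 ->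
  exists2 rho : R, 0 < rho & forall f k, smooth_fn f ->
  exists2 B : R, 0 < B & forall x y, cball x0 rho x -> cball x0 rho y ->
    (forall l, F l x = F l y) -> flat F L K C f x ->
    `|f y - f x| <= B * `|y - x| ^+ k.+1.
Proof.
move=> D0; have [r r0 [c c0 Dc]] := fdet_lower smF D0.
have [Lam Lam0 LamP] := step_size smF C c0 Dc.
have [BF BF0 BFP] := F_chain smF LQ KQ CQ r0 c0 Dc Lam0 LamP.
have [BT BT0 [d d0 BTP]] := transverse smF c0 Dc.
have [kap kap0 kapP] : exists2 kap : R, 0 < kap &
    forall u : 'rV[R]_n, `|u *m K| <= kap * `|u|.
  have [k k0 kP] := sm_mx_bounded x0 r (@sm_cst_mx R n _ _ K).
  exists (n.+1%:R * k); first by rewrite mulr_gt0.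
  move=> u; apply: le_trans (mulmx_norm_le u (ltW k0) _) _.
    apply: (kP x0); rewrite /cball /= subrr normr0; exact: ltW.
  by rewrite ler_wpM2r// ler_wpM2r ?(ltW k0)// ler_nat.
(* [rho] is such that [|y - x|], the length [t] of the path and the distance [Lam * t]
   that it covers add up to at most [m] *)
pose S : R := 1 + kap + Lam * kap.
have Lk0 : 0 < Lam * kap by rewrite mulr_gt0.
have S0 : 0 < S by rewrite /S; lra.
pose m := Num.min (Num.min (r / 2) 1) d.
have [m0 [mr [m1 md]]] : 0 < m /\ m <= r / 2 /\ m <= 1 /\ m <= d.
  by rewrite /m !ge_min !lt_min d0 ltr01 divr_gt0//= !lexx !orbT.
pose rho := m / (S *+ 2).
have rho0 : 0 < rho by rewrite divr_gt0// mulrn_wgt0.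
have rhoS : S * (rho *+ 2) = m by rewrite /rho; field; rewrite gt_eqF.
have rho_r x : cball x0 rho x -> cball x0 (r / 2) x.
  rewrite /cball /= => /le_trans; apply; apply: le_trans mr.
  rewrite -rhoS /S; have := mulr_gt0 kap0 rho0; have := mulr_gt0 Lk0 rho0; lra.
exists rho => // f k sf.
have [Bf Bf0 BfP] := sm_lip x0 r sf.
have [B B0 BP] := flat_chain smF r0 c0 Dc Lam0 LamP k sf.
exists (B * kap ^+ k.+1); first by rewrite mulr_gt0// exprn_gt0.
move=> x y xr yr Fxy fl.
have xy2 : `|y - x| <= rho *+ 2.
  by rewrite -(subrKA x0) mulr2n; apply: le_trans (ler_normD _ _) _; rewrite lerD// distrC.
have xy0 : 0 <= `|y - x| by exact: normr_ge0.
set t := `|(y - x) *m K|.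
have t0 : 0 <= t by exact: normr_ge0.
have tk : t <= kap * `|y - x| by exact: kapP.
have tm : `|y - x| + t + Lam * t <= m.
  rewrite -rhoS; apply: (@le_trans _ _ (S * `|y - x|)); last by rewrite ler_wpM2l// ltW.
  have := ler_wpM2l (ltW Lam0) tk; rewrite /S; lra.
have Lt0 : 0 <= Lam * t by rewrite mulr_ge0// ltW.
apply: (@le_trans _ _ (B * t ^+ k.+1)); last first.
  rewrite -mulrA -exprMn ler_wpM2l ?(ltW B0)//.
  by rewrite lerXn2r ?nnegrE// mulr_ge0// ltW.
have C0 : 0 <= Bf * (BT * BF) * (t * t) + B * (t * t).
  by rewrite addr_ge0// !mulr_ge0// ltW.
apply: (le_inv_succ C0) => N'.
set N := N'.+1; pose s := N%:R^-1 *: ((y - x) *m K).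
have Ns : N%:R *: s = (y - x) *m K by rewrite scalerA mulfV ?scale1r// pnatr_eq0.
have sE : `|s| = t / N%:R by rewrite normrZ ger0_norm ?invr_ge0// mulrC.
have Nt : N%:R * `|s| = t by rewrite sE mulrC divfK// pnatr_eq0.
have sC : s *m C = s by rewrite -scalemxAl -mulmxA KC.
have Lr : Lam * (N%:R * `|s|) <= r / 2 by rewrite Nt; lra.
have t1 : N%:R * `|s| <= 1 by rewrite Nt; lra.
pose z := iter N (step F L K C s) x.
have [zr zx] : cball x0 r z /\ `|z - x| <= Lam * t.
  have [zr zx] := chain_in r0 Lam0 LamP (rho_r _ xr) Lr (leqnn N).
  by split => //; rewrite mulrCA Nt in zx.
have fz : `|f z - f x| <= B * (t ^+ k.+1 + t * `|s|).
  by rewrite -Nt; apply: (BP x s N (rho_r _ xr) fl Lr t1).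
have zy : `|y - z| <= BT * (BF * (t * `|s|)).
  apply: BTP => //.
  - exact: cball_half r0 _ (rho_r _ yr).
  - rewrite mulmxBl (chain_K LQ KQ CQ r0 c0 Dc Lam0 LamP sC (rho_r _ xr) Lr) Ns.
    by rewrite mulmxBl [_ *m K + _]addrC subrK subrr.
  - rewrite -(subrKA x); apply: le_trans (ler_normD _ _) _.
    rewrite [`|x - z|]distrC; lra.
  - by rewrite !mulr_ge0// ltW.
  - by move=> l; have := BFP l x s N (rho_r _ xr) Lr; rewrite Nt -Fxy distrC.
rewrite -(subrKA (f z)); apply: le_trans (ler_normD _ _) _.
have := BfP z y zr (cball_half r0 (rho_r _ yr)).
have := ler_wpM2l (ltW Bf0) zy.
have -> : (Bf * (BT * BF) * (t * t) + B * (t * t)) / N%:R =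
  Bf * (BT * (BF * (t * `|s|))) + B * (t * `|s|) by rewrite sE; field; rewrite pnatr_eq0.
lra.
Qed.

End FlatLocal.

(** * Sard's theorem on a regular level set *)

Section Localize.
Variable R : realType.

Lemma nullU n (A B : set 'rV[R]_n) : null A -> null B -> null (A `|` B).
Proof.
move=> nA nB; apply: (null_sub (B := \bigcup_(b in [set: bool]) if b then A else B)).
  by move=> x [Ax|Bx]; [exists true|exists false].
by apply: null_bigcup => -[].
Qed.

(** Lindelof's argument: cubes with side and centre in a countable set form a
    basis of neighbourhoods, and only those with null image are kept. *)
Lemma null_local n q (A : set 'rV[R]_n) (G : 'rV[R]_n -> 'rV[R]_q) :
  (forall x, A x -> exists2 r : R, 0 < r & null [set G y | y in A `&` cball x r]) ->
  null [set G x | x in A].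
Proof.
move=> locA.
pose cube (t : nat * {ffun 'I_n -> int}) := A `&` [set y : 'rV[R]_n |
  forall i, `|y 0 i - (t.2 i)%:~R / t.1.+1%:R| <= t.1.+1%:R^-1].
apply: (@null_sub _ _ _ (\bigcup_(t in [set t | null [set G y | y in cube t]])
    [set G y | y in cube t])); last by apply: null_bigcup.
move=> _ [x Ax <-]; have [r r0 nr] := locA x Ax.
pose m := Num.truncn (2 / r).
have m0 : 0 < m.+1%:R :> R by [].
have mr : m.+1%:R^-1 *+ 2 <= r.
  rewrite -[_ *+ 2]mulr_natl ler_pdivrMr// mulrC -ler_pdivrMr//.
  by apply/ltW/truncnS_gt.
pose k : {ffun 'I_n -> int} := [ffun i => Num.floor (x 0 i * m.+1%:R)].
have kx i : `|x 0 i - (k i)%:~R / m.+1%:R| <= m.+1%:R^-1.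
  rewrite ffunE; have := floor_itv (x 0 i * m.+1%:R).
  rewrite intrD mulr1z => /andP[h1 h2].
  have -> : x 0 i - (Num.floor (x 0 i * m.+1%:R))%:~R / m.+1%:R =
    (x 0 i * m.+1%:R - (Num.floor (x 0 i * m.+1%:R))%:~R) / m.+1%:R.
    by rewrite mulrBl mulfK// gt_eqF.
  rewrite normrM normfV (gtr0_norm m0) ler_piMl ?invr_ge0 ?(ltW m0)//.
  rewrite ger0_norm; lra.
exists (m, k); last by exists x.
apply: null_sub nr => _ [y [Ay yk] <-]; exists y => //; split => //.
apply: le_trans mr; apply: mxnorm_le; first by rewrite mulrn_wge0// invr_ge0 ltW.
move=> i; rewrite !mxE -(subrKA ((k i)%:~R / m.+1%:R)).
apply: le_trans (ler_normD _ _) _; rewrite mulr2n lerD//.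
by rewrite distrC.
Qed.

Definition inj_mx m k (M : 'M[R]_(m, k)) := forall a : 'cV[R]_k, M *m a = 0 -> a = 0.

Lemma inj_mxP m k (M : 'M[R]_(m, k)) : inj_mx M <-> \rank M = k.
Proof.
split=> [injM|rM a Ma].
  apply/eqP; rewrite -mxrank_tr -[_ == _]/(row_free M^T) -kermx_eq0.
  apply/rowV0P => u /sub_kermxP uM; apply: trmx_inj.
  by rewrite trmx0; apply: injM; rewrite -[M]trmxK -trmx_mul uM trmx0.
have : row_full M by rewrite /row_full rM.
by move=> /row_fullP[B BM]; rewrite -[a]mul1mx -BM -mulmxA Ma mulmx0.
Qed.

(** For a left inverse [B] of [M x], the determinant of [B *m M y] is 1 at
    [y = x], hence nonzero for [y] near [x]. *)
Lemma inj_mx_open n m k (M : 'rV[R]_n -> 'M[R]_(m, k)) : sm_mx M ->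
  open [set x | inj_mx (M x)].
Proof.
move=> sM; rewrite openE => x /= /inj_mxP rM.
have : row_full (M x) by rewrite /row_full rM.
move=> /row_fullP[B BM].
have sB : smooth_fn (fun y => \det (B *m M y)).
  by apply: sm_det; apply: sm_mulmx => //; exact: sm_cst_mx.
have cB := sm_continuous sB; have := cB x.
move=> /cvgrPdist_lt/(_ 1 ltr01); rewrite BM det1; apply: filterS => y /= yd a Ma.
have : \det (B *m M y) != 0.
  by apply: contraTneq yd => ->; rewrite subr0 normr1 ltxx.
rewrite -unitfE -[_ \is a _]/(B *m M y \in unitmx) => uB.
by rewrite -[a](mulKmx uB) -mulmxA Ma !mulmx0.
Qed.

End Localize.

Section Sard.
Variables (R : realType) (n : nat).
Local Notation fn := ('rV[R]_n -> R).

Definition vec q (G : 'I_q -> fn) (x : 'rV[R]_n) : 'rV[R]_q := \row_j G j x.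

(** A nontrivial linear relation between all the gradients that involves those
    of [G]. Where the gradients of [F] are independent this is the failure of
    independence of the gradients of [F] and [G] together. *)
Definition critical p q (F : 'I_p -> fn) (G : 'I_q -> fn) x :=
  exists (a : 'cV[R]_p) (c : 'cV[R]_q), c != 0 /\ grads F x *m a + grads G x *m c = 0.

Definition critset p q (F : 'I_p -> fn) (G : 'I_q -> fn) : set 'rV[R]_n :=
  [set x | (forall l, F l x = 0) /\ inj_mx (grads F x) /\ critical F G x].

Lemma criticalP p q (F : 'I_p -> fn) (G : 'I_q -> fn) x : inj_mx (grads F x) ->
  critical F G x <-> ~ inj_mx (row_mx (grads F x) (grads G x)).
Proof.
move=> injF; split=> [[a [c [c0 ac]]] inj|ninj].
  have : col_mx a c = 0 by apply: inj; rewrite mul_row_col.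
  by rewrite -col_mx0 => /eq_col_mx[_ cc]; rewrite cc eqxx in c0.
apply: contrapT => ncrit; apply: ninj => v; rewrite -[v]vsubmxK mul_row_col => ac.
have c0 : dsubmx v = 0.
  by apply/eqP; apply: contrapT => /negP c0; apply: ncrit; exists (usubmx v), (dsubmx v).
move: ac; rewrite c0 mulmx0 addr0 => /injF ->.
exact: col_mx0.
Qed.

Definition ext p (F : 'I_p -> fn) (f : fn) (i : 'I_p.+1) : fn :=
  if unlift ord0 i is Some l then F l else f.

Lemma sm_ext p (F : 'I_p -> fn) f : (forall l, smooth_fn (F l)) -> smooth_fn f ->
  forall i, smooth_fn (ext F f i).
Proof. by move=> sF sf i; rewrite /ext; case: unlift. Qed.

Lemma grads_ext p (F : 'I_p -> fn) f x (t : R) (a : 'cV[R]_p) :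
  grads (ext F f) x *m col_mx (t%:M : 'M[R]_1) a =
  grads F x *m a + t *: (\col_i pd i f x).
Proof.
apply/colP => i; rewrite [LHS]mxE big_ord_recl [RHS]mxE [RHS]addrC; congr (_ + _).
  have -> : col_mx t%:M a ord0 0 = t.
    rewrite (_ : ord0 = lshift p (0 : 'I_1)); last exact: val_inj.
    by rewrite col_mxEu mxE mulr1n.
  by rewrite !mxE /ext unlift_none mulrC.
rewrite [RHS]mxE; apply: eq_bigr => l _.
have -> : col_mx t%:M a (lift ord0 l) 0 = a l 0.
  by rewrite (_ : lift ord0 l = rshift 1 l) ?col_mxEd//; exact: val_inj.
by rewrite !mxE /ext liftK.
Qed.

Lemma vec_continuous q (G : 'I_q -> fn) : (forall j, smooth_fn (G j)) -> continuous (vec G).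
Proof.
move=> sG x; apply/(@cvgrPdist_le _ _ _ (nbhs x) (nbhs_filter x)) => e e0.
have : \forall y \near x, forall j, `|G j x - G j y| < e.
  apply: (@filter_forall _ _ (fun j y => `|G j x - G j y| < e) (nbhs x)) => j.
  by have cG := sm_continuous (sG j); move/cvgrPdist_lt : (cG x); apply.
apply: filterS => y yP; apply: mxnorm_le; first exact: ltW.
by move=> j; rewrite !mxE ltW.
Qed.

Lemma pd_subc i (f : fn) (t : R) : smooth_fn f -> pd i (fun y => f y - t) = pd i f.
Proof.
move=> sf; apply/funext => x; rewrite /pd.
rewrite (deriveB (f := f) (g := cst t)) ?derive_cst ?subr0//.
exact: diff_derivable (sm_diff x sf).
Qed.

Section Field.
Variables (p : nat) (F : 'I_p -> fn).
Variables (L : 'M[R]_(p, n)) (K C : 'M[R]_n) (Q : 'M[R]_(n, p)).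
Hypotheses (LQ : L *m Q = 1%:M) (KQ : K *m Q = 0) (CQ : C *m Q = 0).
Local Notation Xf := (tder F L K C).

Lemma frame_inj x : fdet F L K x != 0 -> inj_mx (grads F x).
Proof.
move=> D0 a Fa.
have uW : frame F L K x \in unitmx by rewrite unitmxE unitfE.
have : frame F L K x *m (Q *m a) = 0.
  by rewrite mulmxA mulmxDl KQ addr0 -(mulmxA (grads F x)) LQ mulmx1.
move=> /(congr1 (mulmx (invmx (frame F L K x)))); rewrite mulKmx// mulmx0.
by move=> /(congr1 (mulmx L)); rewrite mulmxA LQ mul1mx mulmx0.
Qed.

(** A function with a nonzero tangential derivative has a gradient outside the
    span of the gradients of [F]. *)
Lemma ext_inj f x i : inj_mx (grads F x) -> Xf i f x != 0 -> inj_mx (grads (ext F f) x).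
Proof.
move=> injF Xi v.
pose w : 'cV[R]_(1 + p) := v.
rewrite -[v](vsubmxK w) [usubmx w]mx11_scalar grads_ext.
set t := usubmx w 0 0; set a := dsubmx w => E.
have t0 : t = 0.
  have := @tder_grads R n p F L K C Q LQ KQ CQ i 1 (fun=> f) x a t%:M.
  rewrite big_ord1 mxE eqxx mulr1n => h; apply: (mulfI Xi); rewrite mulr0; apply: h.
  rewrite -[RHS]E; congr (_ + _); apply/colP => k; rewrite !mxE big_ord1 !mxE eqxx mulr1n.
  by rewrite mulrC.
move: E; rewrite t0 scale0r addr0 => /injF ->.
have -> : 0%:M = 0 :> 'M[R]_1 by rewrite -scalemx1 scale0r.
exact: (@col_mx0 R 1 p 1).
Qed.

(** Where some [G j] has a nonzero tangential derivative, the level set of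
    [G j] cuts the level set of [F] transversally, and [x] is critical for the
    other components of [G] on the intersection: a relation that involved [G j]
    alone would make its tangential derivatives vanish. *)
Lemma critset_slice q (G : 'I_q.+1 -> fn) (j : 'I_q.+1) i x :
  (forall j, smooth_fn (G j)) -> critset F G x -> Xf i (G j) x != 0 ->
  critset (ext F (fun y => G j y - G j x)) (fun l => G (lift j l)) x.
Proof.
move=> sG [F0 [injF [a [c [c0 ac]]]]] Xi.
pose g y := G j y - G j x.
have gE k : pd k g = pd k (G j) by exact: pd_subc.
split; [|split].
- by move=> l; rewrite /ext; case: unlift => [l'|]; rewrite ?F0// /g subrr.
- apply: (@ext_inj _ _ i) => //.
  by rewrite /tder; under eq_bigr do rewrite gE.
exists (col_mx (c j 0)%:M a), (\col_l c (lift j l) 0); split.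
  apply: contra Xi => /eqP c'0.
  have c'l l : c (lift j l) 0 = 0 by have /colP/(_ l) := c'0; rewrite !mxE.
  have := tder_grads LQ KQ CQ i ac.
  rewrite (bigD1_ord j)//= big1 ?addr0 => [|l _]; last by rewrite c'l mulr0.
  move=> /eqP; rewrite mulf_eq0 => /orP[//|/eqP cj].
  case/negP: c0; apply/eqP/colP => l; rewrite mxE.
  by case: (unliftP j l) => [l' ->|->].
rewrite grads_ext -addrA -[RHS]ac; congr (_ + _).
apply/colP => k; rewrite !mxE (bigD1_ord j)//= !mxE gE mulrC; congr (_ + _).
by apply: eq_bigr => l _; rewrite !mxE.
Qed.

(** Where [f] vanishes with a nonzero tangential derivative, [f = 0] is a new
    regular constraint. A linear relation between the gradients of [F] and [G]
    persists, with coefficient 0 for the gradient of [f]. *)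
Lemma critset_ext q (G : 'I_q -> fn) f i x :
  critset F G x -> f x = 0 -> Xf i f x != 0 -> critset (ext F f) G x.
Proof.
move=> [F0 [injF [a [c [c0 ac]]]]] f0 Xi; split; [|split].
- by move=> l; rewrite /ext; case: unlift.
- exact: ext_inj Xi.
by exists (col_mx 0%:M a), c; split => //; rewrite grads_ext scale0r addr0.
Qed.

(** Take a shortest word that gives a nonzero derivative, and drop its first
    letter. *)
Lemma tders_first_nonzero f w x : w != [::] -> tders F L K C w f x != 0 ->
  (exists i, Xf i f x != 0) \/
  exists w' i, tders F L K C w' f x = 0 /\ Xf i (tders F L K C w' f) x != 0.
Proof.
elim: w => // i w IH _ /= Xi; case: w IH Xi => [|i' w] IH Xi.
  by left; exists i.
have [w0|w0] := eqVneq (tders F L K C (i' :: w) f x) 0; last exact: IH.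
by right; exists (i' :: w), i.
Qed.

End Field.

End Sard.

Section SardInduction.
Variables (R : realType) (n : nat).
Local Notation fn := ('rV[R]_n -> R).

Lemma sm_closed_eq0 (f : fn) : smooth_fn f -> closed [set x | f x = 0].
Proof.
move=> sf; apply: (@closed_comp _ _ f [set t | t = 0]); last exact: closed_eq.
by move=> x _; have cf := sm_continuous sf; exact: cf.
Qed.

Lemma sm_closed_norm_ge (f : fn) (e : R) : smooth_fn f -> closed [set x | e <= `|f x|].
Proof.
move=> sf; apply: (@closed_comp _ _ (fun x => `|f x|) [set t | e <= t]); last exact: closed_ge.
by move=> x _; have cf := sm_continuous sf; apply: (@cvg_norm _ _ _ (nbhs x)); exact: cf.
Qed.

Lemma closed_cball (x0 : 'rV[R]_n) r : closed (cball x0 r).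
Proof. exact: compact_closed (@cball_compact _ _ _ _). Qed.

Section InductionStep.
Variables (p q : nat) (F : 'I_p -> fn) (G : 'I_q.+1 -> fn).
Hypotheses (smF : forall l, smooth_fn (F l)) (smG : forall j, smooth_fn (G j)).
Hypothesis sard_slice : forall (f : fn) (j : 'I_q.+1), smooth_fn f ->
  null [set vec (fun l => G (lift j l)) x | x in critset (ext F f) (fun l => G (lift j l))].
Hypothesis sard_ext : forall f : fn, smooth_fn f ->
  null [set vec G x | x in critset (ext F f) G].

Section Local.
Variables (L : 'M[R]_(p, n)) (K C : 'M[R]_n) (Q : 'M[R]_(n, p)).
Hypotheses (LQ : L *m Q = 1%:M) (KQ : K *m Q = 0) (CQ : C *m Q = 0).
Local Notation Xf := (tder F L K C).
Local Notation Xwf := (tders F L K C).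
Variables (x0 : 'rV[R]_n) (r : R).
Hypothesis D0 : forall x, cball x0 r x -> fdet F L K x != 0.

(** The lower bound on the derivative makes this set compact; the union over
    [m] covers all the points where the derivative is nonzero. *)
Definition slice_set i j (m : nat) : set 'rV[R]_n :=
  critset F G `&` cball x0 r `&` [set x | m.+1%:R^-1 <= `|Xf i (G j) x|].

(** On the ball the gradients of [F] are independent, so being critical is the
    closed condition that the gradients of [F] and [G] are dependent. *)
Lemma slice_set_compact i j m : compact (slice_set i j m).
Proof.
apply: (subclosed_compact _ (@cball_compact _ _ x0 r)); last by move=> x [[]].
pose noninj := ~` [set x | inj_mx (row_mx (grads F x) (grads G x))].
have -> : slice_set i j m =
    \bigcap_(l in [set: 'I_p]) [set x | F l x = 0] `&` noninj `&` cball x0 r `&`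
    [set x | m.+1%:R^-1 <= `|Xf i (G j) x|].
  apply/seteqP; split=> [x [[[F0 [injF crit]] xr] Xi]|x [[[F0 nin] xr] Xi]].
    by split=> //; split=> //; split; [move=> l _; exact: F0|exact/(criticalP G injF)].
  have injF := frame_inj LQ KQ (D0 xr).
  split=> //; split=> //; split; first by move=> l; exact: F0.
  by split=> //; exact/(criticalP G injF).
apply: closedI; last by apply: sm_closed_norm_ge; exact: sm_tder.
apply: closedI; last exact: closed_cball.
apply: closedI.
  by apply: closed_bigI => l _; exact: sm_closed_eq0.
apply: open_closedC; apply: inj_mx_open => k l.
under eq_fun do rewrite mxE.
by case: (fintype.split l) => l'; exact: sm_grads.
Qed.

(** The slice of the image at [y j = t] consists of critical values of the
    other components on the level set with the additional constraint
    [G j = t]. *)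
Lemma null_slice_set i j m : null [set vec G x | x in slice_set i j m].
Proof.
apply: (@null_of_slices _ _ j).
  apply: continuous_compact; last exact: slice_set_compact.
  by apply: continuous_subspaceT; exact: vec_continuous.
move=> t; apply: (null_sub _ (@sard_slice (fun y => G j y - t) j _)).
  move=> _ [_ [[x [[cx xr] /= Xi] <-]] /= xt <-].
  rewrite mxE in xt; exists x; last by apply/rowP => l; rewrite !mxE.
  rewrite -xt; apply: (critset_slice LQ KQ CQ smG cx (i := i)).
  by rewrite -normr_gt0 (lt_le_trans _ Xi)// invr_gt0.
by apply: smD => //; exact: sm_cst.
Qed.

Definition ext_set w i j : set 'rV[R]_n :=
  critset F G `&` [set x | Xwf w (G j) x = 0 /\ Xf i (Xwf w (G j)) x != 0].

Lemma null_ext_set w i j : null [set vec G x | x in ext_set w i j].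
Proof.
apply: (null_sub _ (@sard_ext (Xwf w (G j)) (sm_tders smF L K C w (smG j)))).
move=> _ [x [cx [f0 Xi]] <-]; exists x => //.
exact: (critset_ext LQ KQ CQ cx f0 Xi).
Qed.

Definition flat_set : set 'rV[R]_n :=
  critset F G `&` cball x0 r `&` [set x | forall j, flat F L K C (G j) x].

Hypothesis flat_est : forall f k, smooth_fn f ->
  exists2 B : R, 0 < B & forall x y, cball x0 r x -> cball x0 r y ->
    (forall l, F l x = F l y) -> flat F L K C f x ->
    `|f y - f x| <= B * `|y - x| ^+ k.+1.

Lemma null_flat_set : 0 < r -> null [set vec G x | x in flat_set].
Proof.
move=> r0.
have [||B B0 BP] := @finite_bound R 'I_q.+1 (fun j B => forall x y,
    cball x0 r x -> cball x0 r y ->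
    (forall l, F l x = F l y) -> flat F L K C (G j) x ->
    `|G j y - G j x| <= B * `|y - x| ^+ n.+1).
- by move=> j; exact: flat_est.
- move=> j a b ab aP x y xr yr Fxy fl; apply: le_trans (aP x y xr yr Fxy fl) _.
  by rewrite ler_wpM2r// exprn_ge0.
apply: (@null_image_flat _ _ _ _ _ (x0 - const_mx r) (r *+ 2 + 1) B).
- by rewrite ltr_pwDr// mulrn_wge0// ltW.
- exact: ltW.
- move=> x [[_ xr] _] i; have := le_trans (coord_le_norm (x - x0) i) xr.
  by rewrite !mxE ler_norml => /andP[? ?]; apply/andP; split; lra.
move=> x y [[[Fx _] xr] fl] [[[Fy _] yr] _].
apply: mxnorm_le => [|j]; first by rewrite mulr_ge0 ?(ltW B0)// exprn_ge0.
by rewrite !mxE; apply: BP => // l; rewrite Fx Fy.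
Qed.

(** The three cases of the classical proof. At a critical point, a first-order
    tangential derivative is nonzero (slices), or a tangential derivative of
    order at least one vanishes and has itself a nonzero tangential derivative
    (one more constraint, same [G]), or all of them vanish (flat points). *)
Lemma null_critset_local : 0 < r ->
  null [set vec G x | x in critset F G `&` cball x0 r].
Proof.
move=> r0.
pose A : set 'rV[R]_q.+1 :=
  \bigcup_(t in [set: 'I_n * 'I_q.+1 * nat]) [set vec G x | x in slice_set t.1.1 t.1.2 t.2].
pose E : set 'rV[R]_q.+1 :=
  \bigcup_(t in [set: seq 'I_n * 'I_n * 'I_q.+1]) [set vec G x | x in ext_set t.1.1 t.1.2 t.2].
apply: (@null_sub _ _ _ (A `|` E `|` [set vec G x | x in flat_set])); last first.
  apply: nullU; last exact: null_flat_set.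
  apply: nullU; apply: null_bigcup => t _; [exact: null_slice_set|exact: null_ext_set].
move=> _ [x [cx xr] <-].
have [fl|nfl] := pselect (forall j, flat F L K C (G j) x); first by right; exists x.
left; have [j /existsNP[w]] : exists j, ~ flat F L K C (G j) x by exact/existsNP.
move=> /not_implyP[w0 /eqP Xw0].
have [[i Xi]|[w' [i [f0 Xi]]]] := tders_first_nonzero w0 Xw0.
  left; exists (i, j, Num.truncn `|Xf i (G j) x|^-1) => //; exists x => //; split => //=.
  have X0 : 0 < `|Xf i (G j) x| by rewrite normr_gt0.
  by rewrite -[leRHS]invrK lef_pV2 ?posrE ?invr_gt0//; exact/ltW/truncnS_gt.
by right; exists (w', i, j) => //; exists x.
Qed.

End Local.

Lemma null_critset_step : null [set vec G x | x in critset F G].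
Proof.
apply: null_local => x0 [_ [injF _]].
have [L [K [C [Q [uW LQ KQ CQ KC]]]]] := tangent_frame ((inj_mxP _).1 injF).
have D0 : fdet F L K x0 != 0 by rewrite -unitfE -unitmxE.
have [r1 r10 flat_est] := flat_estimate smF LQ KQ CQ KC D0.
have [r2 r20 [c c0 Dc]] := fdet_lower smF D0.
pose r := Num.min r1 r2.
have r_gt0 : 0 < r by rewrite lt_min r10.
have rr1 x : cball x0 r x -> cball x0 r1 x by move=> /le_trans; apply; rewrite ge_min lexx.
have rr2 x : cball x0 r x -> cball x0 r2 x by move=> /le_trans; apply; rewrite ge_min lexx orbT.
exists r => //; apply: (null_critset_local LQ KQ CQ) => //.
  by move=> x /rr2/Dc cD; rewrite -normr_gt0 (lt_le_trans c0).
move=> f k sf; have [B B0 BP] := flat_est f k sf; exists B => // x y xr yr.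
by apply: BP; [exact: rr1|exact: rr1].
Qed.

End InductionStep.

(** Every application of the induction hypothesis adds a constraint, and
    [n + 1] functions on [R^n] never have independent gradients. *)
Theorem sard p q (F : 'I_p -> fn) (G : 'I_q -> fn) :
  (forall l, smooth_fn (F l)) -> (forall j, smooth_fn (G j)) ->
  null [set vec G x | x in critset F G].
Proof.
move=> sF sG; have [m] : exists m, (n < p + m)%N by exists n.+1; rewrite addnS ltnS leq_addl.
elim: m p q F G sF sG => [|m IH] p q F G sF sG.
  rewrite addn0 => np; apply: null_sub (@null0 R q) => y [x [_ [/inj_mxP rF _]] _].
  by have := rank_leq_row (grads F x); rewrite rF leqNgt np.
rewrite addnS -addSn => npm; case: q G sG => [|q] G sG.
  apply: null_sub (@null0 R 0) => y [x [_ [_ [a [c [c0 _]]]]] _].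
  by case/negP: c0; apply/eqP/colP => -[].
apply: null_critset_step => // [f j sf|f sf].
  by apply: IH => //; exact: sm_ext.
by apply: IH => //; exact: sm_ext.
Qed.

End SardInduction.

Lemma inj_row_mxC (R : realType) m p q (A : 'M[R]_(m, p)) (B : 'M[R]_(m, q)) :
  inj_mx (row_mx A B) -> inj_mx (row_mx B A).
Proof.
move=> inj v; rewrite -[v]vsubmxK mul_row_col addrC => AB.
have : col_mx (dsubmx v) (usubmx v) = 0 by apply: inj; rewrite mul_row_col.
by rewrite -col_mx0 => /eq_col_mx[-> ->]; exact: col_mx0.
Qed.

(** Subtracting a constant turns the equation [f = t] into a homogeneous one
    and does not change the gradients. *)
Lemma JacE (R : realType) (n m : nat) (f : 'rV[R]_n -> 'rV[R]_m) (t : 'rV[R]_m) x :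
  smooth f -> Jac f x = (grads (fun l y => comp f l y - t 0 l) x)^T.
Proof.
move=> sf; congr (_^T); apply/matrixP => i l.
by rewrite jacobianE// mxE pd_subc//; exact: sm_comp.
Qed.

Theorem theorem4 (R : realType) (n p q : nat)
    (F : 'rV[R]_n -> 'rV[R]_p) (G : 'rV[R]_n -> 'rV[R]_q) (b : 'rV[R]_p)
    (smoothF : smooth F) (smoothG : smooth G)
    (licqF : forall x, level_set F b x -> LICQ F x) :
  for_generic (fun d : 'rV[R]_q => forall x, Nset F G b d x -> LICQ_pair F G x).
Proof.
apply: null_lebesgue.
pose Fb l y := comp F l y - b 0 l.
pose G0 j y := comp G j y - (0 : 'rV[R]_q) 0 j.
have sFb l : smooth_fn (Fb l) by apply: smD; [exact: sm_comp|exact: sm_cst].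
have sG0 j : smooth_fn (G0 j) by apply: smD; [exact: sm_comp|exact: sm_cst].
apply: null_sub (sard sFb sG0) => d /= /existsNP[x /not_implyP[[Fx Gx] nlicq]].
exists x; last by rewrite -Gx; apply/rowP => j; rewrite [LHS]mxE /G0 [(0 : 'rV_q) 0 j]mxE subr0.
have injF : inj_mx (grads Fb x).
  by apply/inj_mxP; rewrite -mxrank_tr -JacE//; exact: licqF.
split; first by move=> l; rewrite /Fb /comp Fx subrr.
split=> //; apply/criticalP => // inj; apply: nlicq.
rewrite /LICQ_pair (JacE b)// (JacE 0)// -tr_row_mx mxrank_tr.
by apply: etrans (addnC q p); apply/inj_mxP; exact: inj_row_mxC.
Qed.
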